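(* Let $\alpha\in\left(0,\frac12\right)$ and $K=n^\alpha$. There exist constants $C_1>0$ and $0<D_1<D_2$ such that the following holds w.h.p. as $n\to\infty$: $$\max_{z\in I}\Psi^{\mathrm{Bern}(1/2)}_K(z)\ \le\ \min\left\{\Psi^{\mathrm{Bern}(1/2)}_K(0),\ \Psi^{\mathrm{Bern}(1/2)}_K\left(\left\lfloor \tfrac K2\right\rfloor\right)\right\}-C_1K\log K,$$ where $I=\mathbb{Z}\cap\left[D_1\sqrt{K\log K},\,D_2\sqrt{K\log K}\right]$. Namely, the planted clique model $\mathbb{G}(n,K,\mathrm{Bern}(1/2))$ exhibits the Overlap Gap Property with parameters $(\zeta_{1,n},\zeta_{2,n},r^1_n,r^2_n)$ given by $$\zeta_{i,n}=D_i\sqrt{K\log K}\ (i=1,2),\qquad r^2_n=\min\left\{\Psi^{\mathrm{Bern}(1/2)}_K(0),\Psi^{\mathrm{Bern}(1/2)}_K\left(\left\lfloor \tfrac K2\right\rfloor\right)\right\},\qquad r^1_n=r^2_n-C_1K\log K.$$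
   Context: $K=n^\alpha$ is regarded as an integer, i.e. $K=\lfloor n^\alpha\rfloor$. The planted clique model $\mathbb{G}(n,K,\mathrm{Bern}(1/2))$: a random graph on $\{1,\dots,n\}$ with planted clique vertex set $\mathcal{PC}=\{1,\dots,K\}$; the edge indicators are $Z_{ij}=1$ if $1\le i<j\le K$, and $Z_{ij}$ i.i.d. Bernoulli$(1/2)$ for all other pairs $i<j$. For $S\subset\{1,\dots,n\}$, $Z_S=\sum_{1\le i<j\le n,\ i,j\in S}Z_{ij}$, also written $|E[S]|$. For integers $z$ with $\lfloor K^2/n\rfloor\le z\le K$, $$\Psi^{\mathrm{Bern}(1/2)}_K(z)=\max_{S\subset\{1,\dots,n\},\ |S|=K,\ |S\cap\mathcal{PC}|=z}Z_S .$$ Overlap Gap Property: given $0<\zeta_{1,n}<\zeta_{2,n}<K$ and $r^2_n>r^1_n>0$, the model exhibits the Overlap Gap Property (OGP) with parameters $(\zeta_{1,n},\zeta_{2,n},r^1_n,r^2_n)$ if w.h.p. as $n\to\infty$: (1) there exist $A,A'\subset\{1,\dots,n\}$ with $|A|=|A'|=K$, $|A\cap\mathcal{PC}|\le\zeta_{1,n}<\zeta_{2,n}\le|A'\cap\mathcal{PC}|$ and $|E[A]|,|E[A']|\ge r^2_n$; (2) every $A\subset\{1,\dots,n\}$ with $|A|=K$ and $\zeta_{1,n}\le|A\cap\mathcal{PC}|\le\zeta_{2,n}$ satisfies $|E[A]|\le r^1_n$. (Here the thresholds $r^1_n,r^2_n$ are allowed to be random.) ''W.h.p.'' means with probability tending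 to $1$. *)

(* Defs.v *)
From mathcomp Require Import all_boot all_order all_algebra.
From mathcomp Require Import all_classical all_reals all_analysis.
Import Order.TTheory GRing.Theory Num.Theory.
Import numFieldNormedType.Exports.

Set Implicit Arguments.
Unset Strict Implicit.
Unset Printing Implicit Defensive.

Local Open Scope classical_set_scope.
Local Open Scope ring_scope.

(* Vertices are 0, ..., n-1 instead of 1, ..., n, so that the planted clique is
   the set of the vertices i < K. *)
Definition vpair (n : nat) : finType :=
  {p : 'I_n * 'I_n | (p.1 < p.2)%N}.

Definition graph (n : nat) : finType := {ffun vpair n -> bool}.

Definition PC (n K : nat) : {set 'I_n} := [set i : 'I_n | (i < K)%N].

Definition inside (n : nat) (S : {set 'I_n}) (p : vpair n) : bool :=
  ((val p).1 \in S) && ((val p).2 \in S).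

Definition edges (n : nat) (Z : graph n) (S : {set 'I_n}) : nat :=
  (\sum_(p : vpair n | inside S p) Z p)%N.

(* The law of G(n, K, Bern(1/2)): the edge indicators are independent, those
   inside the planted clique being Bern(1), i.e. equal to 1. *)
Definition planted_pmf (R : realType) (n K : nat) (Z : graph n) : R :=
  \prod_(p : vpair n)
    bernoulli_pmf (if inside (PC n K) p then 1 else 2^-1) (Z p).

Definition planted_prob (R : realType) (n K : nat) (E : graph n -> Prop) : R :=
  \sum_(Z : graph n | `[< E Z >]) planted_pmf R K Z.

Lemma planted_pmf_ge0 (R : realType) (n K : nat) (Z : graph n) :
  0 <= planted_pmf R K Z.
Proof.
apply: prodr_ge0 => p _; apply: bernoulli_pmf_ge0.
by case: ifP => _; rewrite ?ler01 ?lexx // invr_ge0 ler0n invf_le1 // ler1n.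
Qed.

Lemma planted_prob_total (R : realType) (n K : nat) :
  planted_prob R K (fun _ : graph n => True) = 1.
Proof.
rewrite /planted_prob (eq_bigl xpredT); last by move=> Z; apply/asboolP.
pose q (p : vpair n) : R := if inside (PC n K) p then 1 else 2^-1.
transitivity (\prod_(p : vpair n) \sum_(b : bool) bernoulli_pmf (q p) b).
  by rewrite bigA_distr_bigA.
by apply: big1 => p _; rewrite big_bool /bernoulli_pmf /= addrC subrK.
Qed.

Definition whp (R : realType) (K : nat -> nat)
    (E : forall n : nat, graph n -> Prop) : Prop :=
  (fun n : nat => planted_prob R (K n) (E n)) @ \oo --> (1 : R).

(* The maximum is 0 when no S satisfies the constraints. *)
Definition Psi (n K : nat) (Z : graph n) (z : nat) : nat :=
  (\max_(S : {set 'I_n} | (#|S| == K) && (#|S :&: PC n K| == z)) edges Z S)%N.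

(* The maximum of Psi over the integers z of [a, b]; the bound z <= K is the
   domain of Psi, and the maximum is 0 when there is no such z. *)
Definition max_Psi (R : realType) (n K : nat) (Z : graph n) (a b : R) : nat :=
  (\max_(z < K.+1 | (a <= z%:R <= b)%R) Psi K Z z)%N.

(* r1 and r2 may depend on the graph. The standing assumptions on the
   parameters are part of the property, for all large n, resp. w.h.p. *)
Definition OGP (R : realType) (K : nat -> nat) (zeta1 zeta2 : nat -> R)
    (r1 r2 : forall n : nat, graph n -> R) : Prop :=
  (\forall n \near \oo,
     [/\ 0 < zeta1 n, zeta1 n < zeta2 n & zeta2 n < (K n)%:R]) /\
  whp R K (fun n Z =>
    [/\ 0 < r1 n Z < r2 n Z,
        exists A A' : {set 'I_n},
          [/\ #|A| = K n /\ #|A'| = K n,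
              #|A :&: PC n (K n)|%:R <= zeta1 n,
              zeta2 n <= #|A' :&: PC n (K n)|%:R &
              r2 n Z <= (edges Z A)%:R /\ r2 n Z <= (edges Z A')%:R] &
        forall A : {set 'I_n}, #|A| = K n ->
          zeta1 n <= #|A :&: PC n (K n)|%:R <= zeta2 n ->
          (edges Z A)%:R <= r1 n Z]).

Definition Ksize (R : realType) (alpha : R) (n : nat) : nat :=
  Num.truncn (n%:R `^ alpha).

Definition zeta (R : realType) (K : nat -> nat) (D : R) (n : nat) : R :=
  D * Num.sqrt ((K n)%:R * ln (K n)%:R).

Definition r2 (R : realType) (K : nat -> nat) (n : nat) (Z : graph n) : R :=
  Num.min (Psi (K n) Z 0)%:R (Psi (K n) Z (K n)./2)%:R.

Definition r1 (R : realType) (K : nat -> nat) (C : R) (n : nat) (Z : graph n) :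
    R :=
  r2 R K Z - C * (K n)%:R * ln (K n)%:R.

(* Main.v *)
Require Import Defs.
From mathcomp Require Import all_boot all_order all_algebra.
From mathcomp Require Import all_fingroup.
From mathcomp Require Import all_classical all_reals all_analysis.
From mathcomp Require Import zify ring lra.
Import Order.TTheory GRing.Theory Num.Theory.
Import numFieldNormedType.Exports.

(** The law G(n, K, Bern(1/2)) is the image of the uniform law on graphs under
    the map [plant] that turns on the edges inside the clique, so everything is
    read on a uniform graph [Z]. Write [Y j] for the largest number of edges of
    [Z] spanned by [K] vertices of which at least [j] lie in the clique. Planting
    adds at most [j ^ 2 / 2] edges to a set of overlap [j], that is
    [O(D ^ 2 * K log K)] for [j] of order [D * sqrt (K log K)]. The point is that
    a positive overlap is already costly in the uniform graph: with high
    probability [Y 0 - Y z] is at least [c * z * sqrt (K log n)], which for this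
    [z] is of order [D * K log K]. For small [D] the linear loss beats the
    quadratic gain. Moreover [Y 0] is [Psi] at overlap [0], because [K ^ 2 / n]
    tends to [0] and so, by exchangeability, the densest set avoids the clique;
    and half of the clique, completed arbitrarily, does better still. No precise
    value of [Y 0] enters, hence no second moment is computed.

    The loss is obtained one vertex at a time: for each [j < z], with probability
    [1 - o(1)] uniformly in [j], [Y j >= Y j.+1 + t] with [t] of order
    [sqrt (K log n)]. As [Y] is nonincreasing a failing step costs nothing, so by
    Markov's inequality half of the steps succeed together ([card_small_gain]).
    For one step ([dens_step]), take a maximizer for [Y j.+1], remove from it a
    vertex [p] of the clique, and put instead the best vertex of a reservoir [W]
    of about [sqrt n] vertices, all of which the maximizer avoids with high
    probability ([card_essential]). Given the rest of the graph, [p] and the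
    vertices of [W] are exchangeable, so [p] beats all of them with probability
    at most [1 / #|p |: W|]. To have [p] come within [t] of beating them is more
    likely by a factor of at most a small power of [n], because flipping [t]
    absent edges at [p] would then make it win ([card_near_record]). There are
    [K] choices for [p], and [K * n ^ epsilon / sqrt n] tends to [0] precisely
    because [alpha < 1 / 2].

    The factor in [card_near_record] is under control if [p] sends
    [K / 2 + O(sqrt (K log n))] edges to the maximizer, not more. This is
    [card_unsteady]: the neighbourhood of [p] is distributed as the vertexwise
    majority of three independent neighbourhoods, and the excess of a majority
    over a set yields a total excess [3 / 2] times as large for the three voters.
    An abnormally large excess would make it profitable to insert three new
    vertices and to remove three old ones of ordinary degree, whose existence
    follows from a union bound on the edge counts of all small sets
    ([balanced]); but three given vertices belong to a maximizer with
    probability [O(K / n)] only. *)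

Set Implicit Arguments.
Unset Strict Implicit.
Unset Printing Implicit Defensive.

(** * Adjacency, degrees and edge counts *)

Local Open Scope nat_scope.

Definition adj n (Z : graph n) (u v : 'I_n) : bool :=
  [exists p : vpair n, Z p && ((val p == (u, v)) || (val p == (v, u)))].

Definition of_adj n (h : rel 'I_n) : graph n :=
  [ffun p => h (val p).1 (val p).2].

Definition deg n (Z : graph n) (v : 'I_n) (S : {set 'I_n}) : nat :=
  \sum_(u in S) adj Z v u.

Lemma adj_sym n (Z : graph n) : symmetric (adj Z).
Proof. by move=> u v; apply: eq_existsb => p; rewrite orbC. Qed.

Lemma adj_irr n (Z : graph n) u : adj Z u u = false.
Proof.
apply/existsP => -[[[a b] /= hab]] /andP[_]; rewrite orbb => /eqP[ha hb].
by move: hab; rewrite ha hb ltnn.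
Qed.

Lemma adj_pair n (Z : graph n) (p : vpair n) :
  adj Z (val p).1 (val p).2 = Z p.
Proof.
apply/existsP/idP => [[q /andP[Zq]]|Zp]; last first.
  by exists p; rewrite Zp -surjective_pairing eqxx.
case/orP => /eqP e; first by
  rewrite -surjective_pairing in e; rewrite -(val_inj e).
have := valP q; have := valP p; rewrite e /= => h1 h2.
by have := ltn_trans h1 h2; rewrite ltnn.
Qed.

Lemma adj_of_adj n (h : rel 'I_n) u v :
  symmetric h -> u != v -> adj (of_adj h) u v = h u v.
Proof.
move=> hs; wlog uv : u v / u < v => [W|_].
  move=> ne; have /orP[lt|lt] : (u < v) || (v < u) by rewrite -neq_ltn.
    exact: W.
  by rewrite adj_sym hs; apply: W => //; rewrite eq_sym.
have := adj_pair (of_adj h) (exist _ (u, v) uv : vpair n) => /= ->.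
by rewrite ffunE.
Qed.

Lemma graph_ext n (Z Z' : graph n) :
  (forall u v, u != v -> adj Z u v = adj Z' u v) -> Z = Z'.
Proof.
move=> h; apply/ffunP => p; rewrite -!adj_pair; apply: h.
by rewrite neq_ltn (valP p).
Qed.

Lemma sum_deg n (Z : graph n) (S : {set 'I_n}) :
  \sum_(u in S) deg Z u S = (edges Z S).*2.
Proof.
rewrite /deg pair_big_dep /=.
pose both (p : 'I_n * 'I_n) := (p.1 \in S) && (p.2 \in S).
have -> : \sum_(p | both p) adj Z p.1 p.2 =
    \sum_(p : 'I_n * 'I_n | (p.1 < p.2) && both p) adj Z p.1 p.2 +
    \sum_(p : 'I_n * 'I_n | (p.2 < p.1) && both p) adj Z p.1 p.2.
  rewrite (bigID (fun p : 'I_n * 'I_n => p.1 < p.2)) /=; congr (_ + _).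
    by apply: eq_bigl => p; rewrite andbC.
  rewrite [in LHS](bigID (fun p : 'I_n * 'I_n => p.2 < p.1)) /=.
  rewrite [X in _ + X]big1 ?addn0.
    by apply: eq_bigl => p; rewrite andbC; case: ltngtP; rewrite ?andbT ?andbF.
  move=> [u v] /=; rewrite -!leqNgt => /andP[/andP[_ h1] h2].
  have -> : u = v by apply/val_inj/eqP; rewrite eqn_leq h1 h2.
  by rewrite adj_irr.
have e : \sum_(p : 'I_n * 'I_n | (p.1 < p.2) && both p) adj Z p.1 p.2 = edges Z S.
  rewrite /edges (reindex_omap (fun p : vpair n => val p) insub) /=; last first.
    by move=> p /andP[h _]; rewrite insubT.
  apply: eq_big => p; first by rewrite (valP p) /= valK eqxx andbT.
  by rewrite adj_pair.
rewrite -addnn -{2}e e; congr (_ + _).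
rewrite -e (reindex_inj (h := fun p : 'I_n * 'I_n => (p.2, p.1))) /=; last first.
  by move=> [a b] [c d] /= [-> ->].
apply: eq_big => p /=; first by rewrite /both [(p.2 \in S) && _]andbC.
by rewrite adj_sym.
Qed.

Lemma edges_adj n (Z Z' : graph n) (S : {set 'I_n}) :
  {in S &, forall u v, adj Z u v = adj Z' u v} -> edges Z S = edges Z' S.
Proof.
move=> h; apply: double_inj; rewrite -!sum_deg.
by apply: eq_bigr => u uS; apply: eq_bigr => v vS; rewrite h.
Qed.

Lemma deg_adj n (Z Z' : graph n) v (S : {set 'I_n}) :
  {in S, forall u, adj Z v u = adj Z' v u} -> deg Z v S = deg Z' v S.
Proof. by move=> h; apply: eq_bigr => u uS; rewrite h. Qed.

Lemma edges_add n (Z : graph n) v (S : {set 'I_n}) :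
  v \notin S -> edges Z (v |: S) = edges Z S + deg Z v S.
Proof.
move=> vS; apply: double_inj; rewrite -sum_deg big_setU1 //= doubleD -sum_deg.
rewrite {1}/deg big_setU1 //= adj_irr add0n.
have -> : \sum_(u in S) deg Z u (v |: S) = \sum_(u in S) (adj Z v u + deg Z u S).
  by apply: eq_bigr => u _; rewrite {1}/deg big_setU1 //= adj_sym.
by rewrite big_split /= -/(deg Z v S) addnA addnn addnC.
Qed.

Lemma edges_rem n (Z : graph n) v (S : {set 'I_n}) :
  v \in S -> edges Z S = edges Z (S :\ v) + deg Z v S.
Proof.
move=> vS; rewrite -{1}(finset.setD1K vS) edges_add ?finset.setD11 //; congr (_ + _).
by rewrite {2}/deg (big_setD1 v) //= adj_irr.
Qed.

Lemma card_inside n (S : {set 'I_n}) :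
  (\sum_(p : vpair n | inside S p) 1).*2 = #|S| * #|S|.-1.
Proof.
pose Z1 : graph n := of_adj (fun _ _ => true).
have -> : \sum_(p : vpair n | inside S p) 1 = edges Z1 S.
  by apply: eq_bigr => p _; rewrite ffunE.
rewrite -sum_deg -sum_nat_const; apply: eq_bigr => u uS.
rewrite /deg (big_setD1 u) //= adj_irr add0n (cardsD1 u S) uS /= -sum1_card.
by apply: eq_bigr => v; rewrite !inE => /andP[ne _]; rewrite adj_of_adj // eq_sym.
Qed.

(** * Finite sets of prescribed size *)

Lemma card_eq_sum (T : finType) (Q : pred T) : #|[set x | Q x]| = \sum_x Q x.
Proof. by rewrite -sum1dep_card big_mkcond; apply: eq_bigr => x _; case: (Q x). Qed.

Lemma card_bigcup_le (T I : finType) (Q : {pred I}) (A : I -> {set T}) :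
  #|\bigcup_(i in Q) A i| <= \sum_(i in Q) #|A i|.
Proof.
elim/big_ind2: _ => [|a A' b B' hA hB|i _] //; first by rewrite cards0.
by rewrite (leq_trans (leq_card_setU _ _)) // leq_add.
Qed.

Lemma exists_subset_card (T : finType) (A : {set T}) m : m <= #|A| ->
  exists2 B : {set T}, B \subset A & #|B| = m.
Proof.
move=> /card_geqP[s [us cs sA]]; exists [set:: s].
  by apply/fintype.subsetP => v; rewrite inE => /sA.
by rewrite cardsE (card_uniqP us).
Qed.

Lemma card_PC n K : K <= n -> #|PC n K| = K.
Proof.
move=> Kn; rewrite -sum1_card (eq_bigl (fun i : 'I_n => i < K)); last first.
  by move=> i; rewrite inE.
by rewrite (big_ord_narrow Kn) /= sum_nat_const card_ord muln1.
Qed.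

Lemma ffact_leq_expn a t : a ^_ t <= a ^ t.
Proof.
rewrite ffact_prod -[in leqRHS](card_ord t) -prod_nat_const.
by apply: leq_prod => i _; apply: leq_subr.
Qed.

Lemma expn_leq_ffact b t : (b - t) ^ t <= b ^_ t.
Proof.
rewrite ffact_prod -[X in _ ^ X <= _](card_ord t) -prod_nat_const.
by apply: leq_prod => i _; apply: leq_sub2l; apply: ltnW.
Qed.

(** The factors of the falling factorial of [a] are at most [a], those of the
    falling factorial of [b] at least [b - t]. *)
Lemma bin_ratio a b t : 'C(a, t) * (b - t) ^ t <= 'C(b, t) * a ^ t.
Proof.
rewrite -(leq_pmul2r (fact_gt0 t)) mulnAC bin_ffact [leqRHS]mulnAC bin_ffact.
by rewrite mulnC leq_mul ?expn_leq_ffact ?ffact_leq_expn.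
Qed.

Lemma card_small_sets n m : m.+1 <= n ->
  #|[set S : {set 'I_n} | #|S| <= m]| <= n ^ m.+1.
Proof.
move=> mn; have n0 : 0 < n by apply: leq_trans mn.
have -> : #|[set S : {set 'I_n} | #|S| <= m]| = \sum_(j < m.+1) 'C(n, j).
  under [RHS]eq_bigr => j _ do rewrite -{1}[n]card_ord -card_draws card_eq_sum.
  rewrite card_eq_sum exchange_big /=; apply: eq_bigr => S _.
  case: leqP => h.
    rewrite (bigD1 (Ordinal (h : #|S| < m.+1))) //= eqxx big1 // => j.
    by rewrite -val_eqE /= eq_sym => /negPf ->.
  rewrite big1 // => j _; apply/eqP; rewrite eqb0; apply: contraTneq h => ->.
  by rewrite -leqNgt -ltnS.
rewrite expnS; apply: (@leq_trans (m.+1 * n ^ m)); last by rewrite leq_mul2r mn orbT.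
rewrite -[in leqRHS](card_ord m.+1) -sum_nat_const; apply: leq_sum => j _.
apply: (@leq_trans (n ^ j)); last by rewrite leq_pexp2l // -ltnS.
apply: leq_trans (ffact_leq_expn n j); rewrite -bin_ffact.
by rewrite leq_pmulr ?fact_gt0.
Qed.

(** * Relabelling vertices, and vertices that matter to a maximum *)

Lemma disjoint_setU1r (T : finType) (v : T) (S X : {set T}) :
  [disjoint S & v |: X] = (v \notin S) && [disjoint S & X].
Proof.
by rewrite !finset.disjoints_subset finset.setCU finset.subsetI
  -!finset.disjoints_subset disjoint_sym disjoints1.
Qed.

Definition relab n (Z : graph n) (s : 'S_n) : graph n :=
  of_adj (fun u v => adj Z (s u) (s v)).

Lemma adj_relab n (Z : graph n) (s : 'S_n) u v :
  adj (relab Z s) u v = adj Z (s u) (s v).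
Proof.
have [->|ne] := eqVneq u v; first by rewrite !adj_irr.
by rewrite adj_of_adj // => a b; rewrite adj_sym.
Qed.

Lemma relab_inj n (s : 'S_n) : injective (fun Z : graph n => relab Z s).
Proof.
move=> Z Z' e; apply: graph_ext => u v _.
by rewrite -[u](permKV s) -[v](permKV s) -!adj_relab /= e.
Qed.

Lemma deg_relab n (Z : graph n) (s : 'S_n) v (S : {set 'I_n}) :
  deg (relab Z s) v S = deg Z (s v) (s @: S).
Proof.
rewrite /deg big_imset /=; last by move=> ? ? _ _; apply: perm_inj.
by apply: eq_bigr => u _; rewrite adj_relab.
Qed.

Lemma edges_relab n (Z : graph n) (s : 'S_n) (S : {set 'I_n}) :
  edges (relab Z s) S = edges Z (s @: S).
Proof.
apply: double_inj; rewrite -!sum_deg big_imset /=; last by move=> ? ? _ _;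
  apply: perm_inj.
by apply: eq_bigr => u _; rewrite deg_relab.
Qed.

Lemma imset_tperm_id n (a b : 'I_n) (X : {set 'I_n}) :
  a \notin X -> b \notin X -> tperm a b @: X = X.
Proof.
move=> aX bX; rewrite -[RHS]imset_id; apply: eq_in_imset => x xX.
rewrite tpermD //; first by apply: contraNneq aX => ->.
by apply: contraNneq bX => ->.
Qed.

Definition fam n (P : {set 'I_n}) (k m : nat) (X : {set 'I_n}) :
    {set {set 'I_n}} :=
  [set S : {set 'I_n} | [&& #|S| == k, m <= #|S :&: P| & [disjoint S & X]]].

Definition dens n (Z : graph n) (P : {set 'I_n}) (k m : nat)
    (X : {set 'I_n}) : nat :=
  \max_(S in fam P k m X) edges Z S.

Lemma dens_ge n (Z : graph n) (P : {set 'I_n}) k m X (S : {set 'I_n}) :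
  S \in fam P k m X -> edges Z S <= dens Z P k m X.
Proof. by move=> h; rewrite /dens; apply: leq_bigmax_cond. Qed.

Lemma dens_attained n (Z : graph n) (P : {set 'I_n}) k m X :
  fam P k m X != finset.set0 ->
  exists2 S, S \in fam P k m X & edges Z S = dens Z P k m X.
Proof.
move=> /set0Pn[S0 h0].
have c0 : 0 < #|fam P k m X| by apply/card_gt0P; exists S0.
have [S SF e] := eq_bigmax_cond (edges Z) c0.
by exists S.
Qed.

Lemma dens_mono n (Z : graph n) (P : {set 'I_n}) k m m' (X X' : {set 'I_n}) :
  m <= m' -> X \subset X' -> dens Z P k m' X' <= dens Z P k m X.
Proof.
move=> mm XX; apply/bigmax_leqP => S; rewrite inE => /and3P[h1 h2 h3].
apply: dens_ge; rewrite inE h1 (leq_trans mm h2) /=.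
by rewrite disjoint_sym (disjointWl XX) // disjoint_sym.
Qed.

Lemma dens_relab n (Z : graph n) (P : {set 'I_n}) k m (X : {set 'I_n})
    (s : 'S_n) :
  s @: P = P -> dens (relab Z s) P k m X = dens Z P k m (s @: X).
Proof.
move=> sP; have inj : injective s by exact: perm_inj.
rewrite /dens [RHS](reindex_inj (imset_inj inj)) /=.
apply: eq_big => S; last by rewrite edges_relab.
rewrite !inE card_imset // imset_disjoint //; congr [&& _, _ & _].
by rewrite -{2}sP -imsetI ?card_imset // => ? ? _ _; apply: inj.
Qed.

(** A vertex whose removal lowers the maximum lies in every maximizer, so a
    graph has at most [k] such vertices, and all vertices outside [P] and [X]
    are equally likely to be one. *)
Lemma card_essential1 n (P : {set 'I_n}) k m (X : {set 'I_n}) w :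
  w \notin P :|: X ->
  #|~: (P :|: X)| * #|[set Z | dens Z P k m (w |: X) < dens Z P k m X]|
    <= k * #|graph n|.
Proof.
move=> wPX.
pose E v := [set Z | dens Z P k m (v |: X) < dens Z P k m X].
have eqE v : v \in ~: (P :|: X) -> #|E v| = #|E w|.
  rewrite finset.in_setC => vPX.
  rewrite !card_eq_sum (reindex_inj (@relab_inj _ (tperm v w))) /=.
  move: vPX wPX; rewrite !inE !negb_or => /andP[vP vX] /andP[wP wX].
  apply: eq_bigr => Z _; rewrite !dens_relab ?(@imset_tperm_id _ _ _ P) //.
  by rewrite imsetU1 tpermL imset_tperm_id.
rewrite -sum_nat_const -(eq_bigr _ eqE).
under eq_bigr do rewrite card_eq_sum.
rewrite exchange_big /=.
apply: (@leq_trans (\sum_(Z : graph n) k)); last by rewrite sum_nat_const mulnC.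
apply: leq_sum => Z _.
have [F0|/dens_attained-/(_ Z)[S SF eS]] := eqVneq (fam P k m X) finset.set0.
  by rewrite big1 // => v _; rewrite [dens Z P k m X]/dens F0 big_set0 ltn0.
have /and3P[/eqP cS h2 h3] : [&& #|S| == k, m <= #|S :&: P| & [disjoint S & X]].
  by move: SF; rewrite inE.
rewrite -[leqRHS]cS -sum1_card [leqRHS]big_mkcond [leqLHS]big_mkcond /=;
  apply: leq_sum => v _.
case: ifP => // _; case: ltnP => //; case: (boolP (v \in S)) => // vS.
rewrite -eS ltnNge dens_ge // inE /=.
move: SF; rewrite inE => /and3P[-> -> _] /=.
by rewrite disjoint_setU1r vS.
Qed.

(** The same for several vertices, removed one after the other. *)
Lemma card_essential n (P : {set 'I_n}) k m (X W : {set 'I_n}) N :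
  [disjoint W & P :|: X] -> N <= #|~: (P :|: (W :|: X))| ->
  N * #|[set Z | dens Z P k m (W :|: X) < dens Z P k m X]|
    <= #|W| * k * #|graph n|.
Proof.
elim: {W}#|W| {-2}W (erefl #|W|) => [|c IH] W cW dW hN.
  move/eqP: cW; rewrite cards_eq0 => /eqP ->; rewrite finset.set0U cards0.
  by rewrite [X in _ * X](_ : _ = 0) ?muln0 //; apply: eq_card0 => Z; rewrite inE ltnn.
have /card_gt0P[w wW] : 0 < #|W| by rewrite cW.
have cW' : #|W :\ w| = c by move: cW; rewrite (cardsD1 w) wW => -[].
have eW : W :|: X = w |: ((W :\ w) :|: X) by rewrite finset.setUA finset.setD1K.
have wPX : w \notin P :|: X by rewrite (disjointFr dW wW).
have sub : ~: (P :|: (W :|: X)) \subset ~: (P :|: ((W :\ w) :|: X)).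
  by rewrite finset.setCS finset.setUS // eW finset.subsetUr.
have hN' : N <= #|~: (P :|: ((W :\ w) :|: X))|.
  by apply: leq_trans hN _; apply: subset_leq_card.
have dW' : [disjoint W :\ w & P :|: X].
  by apply: disjointWl dW; apply: subD1set.
have w1 : w \notin P :|: ((W :\ w) :|: X).
  move: wPX; rewrite !inE !negb_or eqxx /= => /andP[-> ->] //.
have {}IH := IH _ cW' dW' hN'.
have h1 := card_essential1 k m w1.
rewrite cW' in IH; rewrite eW cW mulSn mulnDl.
have {}h1 := leq_trans (leq_mul hN' (leqnn _)) h1.
apply: leq_trans (leq_add h1 IH).
rewrite -mulnDr leq_mul // -cardsUI (leq_trans _ (leq_addr _ _)) //.
apply/subset_leq_card/fintype.subsetP => Z; rewrite !inE => h.
by rewrite orbC; case: (ltnP _ (dens Z P k m X)) => //= h'; apply: leq_trans h h'.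
Qed.

(** * Records and near records *)

Definition reach n (Z : graph n) (F : {set {set 'I_n}}) (v : 'I_n) : nat :=
  \max_(S in F) (edges Z S + deg Z v S).

Lemma reach_ge n (Z : graph n) (F : {set {set 'I_n}}) v (S : {set 'I_n}) :
  S \in F -> edges Z S + deg Z v S <= reach Z F v.
Proof. by move=> h; rewrite /reach; apply: leq_bigmax_cond. Qed.

(** The vertices of [p |: W] see a family of sets avoiding them all in the same
    way, so [p] is the strict winner with probability at most [1 / #|p |: W|]. *)
Lemma card_record n (F : {set {set 'I_n}}) (p : 'I_n) (W : {set 'I_n}) :
  p \notin W -> (forall S, S \in F -> [disjoint S & p |: W]) ->
  #|W|.+1 * #|[set Z | [forall w in W, reach Z F w < reach Z F p]]|
    <= #|graph n|.
Proof.
move=> pW hF.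
pose A v := [set Z | [forall w in (p |: W) :\ v, reach Z F w < reach Z F v]].
have eA v : v \in p |: W -> #|A v| = #|[set Z | [forall w in W,
  reach Z F w < reach Z F p]]|.
  move=> vW; rewrite !card_eq_sum (reindex_inj (@relab_inj _ (tperm p v))) /=.
  have e Z u : reach (relab Z (tperm p v)) F u = reach Z F (tperm p v u).
    apply: eq_bigr => S /hF; rewrite finset.disjoints_subset => /fintype.subsetP dS.
    have eS : tperm p v @: S = S.
      apply: imset_tperm_id.
        by apply/negP => /dS; rewrite !inE eqxx.
      by apply/negP => /dS; move: vW; rewrite !inE => ->.
    by rewrite edges_relab deg_relab eS.
  apply: eq_bigr => Z _; congr nat_of_bool.
  apply/forall_inP/forall_inP => h w hw.
    have := h (tperm p v w); rewrite !e tpermR tpermK; apply; rewrite !inE.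
    have wp : w != p by apply: contraNneq pW => <-.
    case: tpermP => [e1|e1|_ /eqP ->]; last by rewrite hw orbT.
      by rewrite e1 eqxx in wp.
    by rewrite eqxx andbT -e1 eq_sym.
  rewrite !e tpermR; apply: h; move: hw; rewrite !inE.
  case: tpermP => [->|->|]; rewrite ?eqxx //=.
    by rewrite andbT eq_sym => vp; move: vW; rewrite !inE (negPf vp).
  by move=> /eqP/negPf -> _ /andP[].
have -> : #|W|.+1 = #|p |: W| by rewrite cardsU1 pW.
rewrite -sum_nat_const -(eq_bigr _ eA).
under eq_bigr do rewrite card_eq_sum.
rewrite exchange_big /=.
apply: (@leq_trans (\sum_(Z : graph n) 1)); last by rewrite sum1_card.
apply: leq_sum => Z _.
have [-> //|] := eqVneq (\sum_(v in p |: W) nat_of_bool [forall w in (p |: W) :\ v,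
  reach Z F w < reach Z F v]) 0.
rewrite sum_nat_eq0 negb_forall => /existsP[v]; rewrite negb_imply => /andP[vW].
rewrite eqb0 negbK => /forall_inP hv.
rewrite (bigD1 v) //= big1 ?addn0 ?leq_b1 // => w /andP[wW wv].
apply/eqP; rewrite eqb0; apply/negP => /forall_inP hw.
have := hv w; have := hw v; rewrite !finset.in_setD1 vW wW wv eq_sym wv => /(_ isT) h1
  /(_ isT) h2.
by have := ltn_trans h1 h2; rewrite ltnn.
Qed.

Definition flip n (Z : graph n) (p : 'I_n) (I : {set 'I_n}) : graph n :=
  of_adj (fun u v => adj Z u v (+) (((u == p) && (v \in I)) || ((v == p) && (u \in I)))).

Lemma adj_flip n (Z : graph n) (p : 'I_n) (I : {set 'I_n}) u v : u != v ->
  adj (flip Z p I) u v =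
  adj Z u v (+) (((u == p) && (v \in I)) || ((v == p) && (u \in I))).
Proof. by move=> ne; rewrite adj_of_adj // => a b; rewrite adj_sym orbC. Qed.

Lemma flipK n (p : 'I_n) (I : {set 'I_n}) : involutive (fun Z : graph n => flip Z p I).
Proof. by move=> Z; apply: graph_ext => u v ne;
  rewrite !adj_flip // -addbA addbb addbF. Qed.

Lemma edges_flip n (Z : graph n) (p : 'I_n) (I S : {set 'I_n}) :
  p \notin S -> edges (flip Z p I) S = edges Z S.
Proof.
move=> pS; apply: edges_adj => u v uS vS.
have [->|ne] := eqVneq u v; first by rewrite !adj_irr.
have up : (u == p) = false by apply: contraNF pS => /eqP <-.
have vp : (v == p) = false by apply: contraNF pS => /eqP <-.
by rewrite adj_flip // up vp addbF.
Qed.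

Lemma deg_flip_other n (Z : graph n) (p w : 'I_n) (I S : {set 'I_n}) :
  w != p -> w \notin I -> w \notin S -> deg (flip Z p I) w S = deg Z w S.
Proof.
move=> /negPf wp /negPf wI wS; apply: deg_adj => u uS.
have wu : w != u by apply: contraNneq wS => ->.
by rewrite adj_flip // wp wI andbF addbF.
Qed.

Lemma deg_flip n (Z : graph n) (p : 'I_n) (I S : {set 'I_n}) :
  p \notin S -> {in I, forall u, adj Z p u} ->
  deg Z p S = deg (flip Z p I) p S + #|I :&: S|.
Proof.
move=> pS hI; rewrite -sum1_card.
rewrite (eq_bigl (fun u => (u \in S) && (u \in I))); last first.
  by move=> u; rewrite inE andbC.
rewrite big_mkcondr /deg -big_split /=; apply: eq_bigr => u uS.
have ne : p != u by apply: contraNneq pS => ->.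
rewrite adj_flip // eqxx [u == p]eq_sym (negPf ne) /= orbF.
by case: (boolP (u \in I)) => [/hI ->|_]; rewrite ?addbF ?addn0.
Qed.

(** If [B1] is a maximizer once the edges from [p] to [I] are deleted, and [B2]
    once those to [J] are deleted, adding up the two optimality inequalities
    leaves no room for an element of [J] outside [B1]. *)
Lemma flip_maximizers n (Z : graph n) (p : 'I_n) (I J B1 B2 : {set 'I_n}) :
  p \notin B1 -> p \notin B2 -> I \subset B1 -> J \subset B2 -> #|I| = #|J| ->
  {in I, forall u, adj Z p u} -> {in J, forall u, adj Z p u} ->
  edges (flip Z p I) B2 + deg (flip Z p I) p B2
    <= edges (flip Z p I) B1 + deg (flip Z p I) p B1 ->
  edges (flip Z p J) B1 + deg (flip Z p J) p B1
    <= edges (flip Z p J) B2 + deg (flip Z p J) p B2 ->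
  J \subset B1.
Proof.
move=> pB1 pB2 I1 J2 cIJ hI hJ; rewrite !edges_flip //.
have e1 := deg_flip pB1 hI; have e2 := deg_flip pB2 hI.
have e3 := deg_flip pB1 hJ; have e4 := deg_flip pB2 hJ.
have i2 : #|I :&: B2| <= #|I| by rewrite subset_leq_card // finset.subsetIl.
have eI : #|I :&: B1| = #|I| by rewrite (finset.setIidPl I1).
have eJ : #|J :&: B2| = #|J| by rewrite (finset.setIidPl J2).
move=> o1 o2; have cJ : #|J| <= #|J :&: B1| by lia.
by apply/finset.setIidPl/eqP; rewrite eqEcard finset.subsetIl.
Qed.

Definition near_record n (F : {set {set 'I_n}}) (W : {set 'I_n}) (D t : nat)
    (p : 'I_n) : {set graph n} :=
  [set Z | [exists S in F,
    [&& edges Z S + deg Z p S == reach Z F p, deg Z p S <= D &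
        [forall w in W, reach Z F w < reach Z F p + t]]]].

(** Raising by [t] the degree of [p] into a maximizer turns a near record into a
    record, so near records are hardly more frequent than records: there are
    at least 'C(k - D, t) ways to choose the [t] absent edges to add, and
    [flip_maximizers] bounds by 'C(D + t, t) the number of ways to undo it. *)
Lemma card_near_record n (F : {set {set 'I_n}}) (k D t : nat) (p : 'I_n)
    (W : {set 'I_n}) :
  p \notin W ->
  (forall S, S \in F -> #|S| = k /\ [disjoint S & p |: W]) ->
  #|W|.+1 * (#|near_record F W D t p| * 'C(k - D, t))
    <= 'C(D + t, t) * #|graph n|.
Proof.
move=> pW hF.
pose Q Z S := [&& S \in F, edges Z S + deg Z p S == reach Z F p, deg Z p S <= D &
          [forall w in W, reach Z F w < reach Z F p + t]].
set A := near_record F W D t p.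
pose A' := [set Z | [forall w in W, reach Z F w < reach Z F p]].
have [B QA] : exists B, forall Z, Z \in A -> Q Z (B Z).
  exists (fun Z => odflt finset.set0 [pick S | Q Z S]) => Z.
  rewrite inE => /existsP[S hS]; case: pickP => [//|/(_ S)].
  by rewrite /Q hS.
have pF S : S \in F -> p \notin S.
  move=> /hF[_]; rewrite finset.disjoints_subset => /fintype.subsetP dS.
  by apply/negP => /dS; rewrite !inE eqxx.
have wF w S : w \in W -> S \in F -> w \notin S.
  move=> wW /hF[_]; rewrite finset.disjoints_subset => /fintype.subsetP dS.
  by apply/negP => /dS; rewrite !inE wW orbT.
have QF Z : Z \in A -> B Z \in F by move=> /QA/and4P[].
pose V Z (I : {set 'I_n}) := [&& I \subset B Z, #|I| == t & [forall u in I,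
  ~~ adj Z p u]].
pose Pre Z := [set I | (flip Z p I \in A) && V (flip Z p I) I].
(* Pairs of a configuration in [A] and of [t] absent edges at [p] to flip. *)
have lower : #|A| * 'C(k - D, t) <= \sum_Z #|Pre Z|.
  under [leqRHS]eq_bigr do rewrite card_eq_sum.
  rewrite exchange_big /=.
  under eq_bigr => I _.
    rewrite (reindex_inj (inv_inj (@flipK _ p I))) /=.
    under eq_bigr do rewrite flipK.
    over.
  rewrite exchange_big /= -sum_nat_const big_mkcond /=; apply: leq_sum => Z _.
  case: ifP => // ZA; rewrite -card_eq_sum.
  have [/hF[cB _] _ dB _] := and4P (QA Z ZA).
  have -> : #|[set I | V Z I]| = 'C(#|[set u in B Z | ~~ adj Z p u]|, t).
    rewrite -cards_draws; apply: eq_card => I; rewrite !inE /V.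
    apply/and3P/andP => [[/fintype.subsetP h1 h2 /forall_inP h3]|[/fintype.subsetP h1
      h2]]; split => //.
    - by apply/fintype.subsetP => u uI; rewrite inE h1 // h3.
    - by apply/fintype.subsetP => u /h1; rewrite inE => /andP[].
    - by apply/forall_inP => u /h1; rewrite inE => /andP[].
  apply: leq_bin2l; rewrite leq_subLR -cB.
  have -> : #|B Z| = deg Z p (B Z) + #|[set u in B Z | ~~ adj Z p u]|.
    rewrite -!sum1_card /deg [X in _ + X](eq_bigl (fun u => (u \in B Z) && ~~ adj Z p u)).
      by rewrite big_mkcondr /= -big_split /=; apply: eq_bigr => u _; case: (adj Z p u).
    by move=> u; rewrite inE.
  by rewrite leq_add2r.
have upper : \sum_Z #|Pre Z| <= #|A'| * 'C(D + t, t).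
  rewrite -sum_nat_const [leqRHS]big_mkcond; apply: leq_sum => Z _.
  have [->|/set0Pn[I]] := eqVneq (Pre Z) finset.set0; first by rewrite cards0.
  rewrite inE => /andP[ZI VI]; set Z1 := flip Z p I in ZI VI.
  have present (J : {set 'I_n}) : V (flip Z p J) J -> flip Z p J \in A -> {in J,
    forall u, adj Z p u}.
    move=> /and3P[/fintype.subsetP h1 _ /forall_inP h3] /QF/pF pB u uJ.
    have pu : p != u by apply/eqP => e; case/negP: pB; rewrite {1}e; apply: h1.
    have := h3 _ uJ; rewrite adj_flip // eqxx uJ /=.
    by case: (adj Z p u).
  have [B1F /eqP opt1 dB1 /forall_inP hW] := and4P (QA Z1 ZI).
  have presI := present _ VI ZI.
  have /and3P[I1 /eqP cI _] := VI.
  have dI : #|I :&: B Z1| = t by rewrite (finset.setIidPl I1).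
  have eB1 : edges Z (B Z1) + deg Z p (B Z1) = reach Z1 F p + t.
    by rewrite (@deg_flip _ Z p I) ?pF // dI addnA -(@edges_flip _ Z p I) ?pF // opt1.
  have -> : Z \in A'.
    rewrite inE; apply/forall_inP => w wW.
    have e : reach Z F w = reach Z1 F w.
      apply: eq_bigr => S SF; have wp : w != p by apply: contraNneq pW => <-.
      have wI : w \notin I.
        by apply/negP => /(fintype.subsetP I1); apply/negP; apply: wF.
      by rewrite edges_flip ?pF // deg_flip_other // wF.
    rewrite e; apply: leq_trans (hW w wW) _.
    by rewrite -eB1 reach_ge.
  apply: (@leq_trans 'C(#|[set u in B Z1 | adj Z p u]|, t)); last first.
    apply: leq_bin2l.
    have -> : #|[set u in B Z1 | adj Z p u]| = deg Z p (B Z1).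
      rewrite -sum1_card /deg (eq_bigl (fun u => (u \in B Z1) && adj Z p u)).
        by rewrite big_mkcondr; apply: eq_bigr => u _; case: (adj Z p u).
      by move=> u; rewrite inE.
    by rewrite (@deg_flip _ Z p I) ?pF // dI leq_add2r.
  rewrite -cards_draws; apply/subset_leq_card/fintype.subsetP => J.
  rewrite finset.in_set => /andP[ZJ VJ]; set Z2 := flip Z p J in ZJ VJ.
  have [B2F /eqP opt2 _ _] := and4P (QA Z2 ZJ).
  have presJ := present _ VJ ZJ.
  have /and3P[J2 /eqP cJ _] := VJ.
  have o1 : edges Z1 (B Z2) + deg Z1 p (B Z2) <= edges Z1 (B Z1) + deg Z1 p (B Z1).
    exact: leq_trans (reach_ge Z1 p B2F) (eq_leq (esym opt1)).
  have o2 : edges Z2 (B Z1) + deg Z2 p (B Z1) <= edges Z2 (B Z2) + deg Z2 p (B Z2).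
    exact: leq_trans (reach_ge Z2 p B1F) (eq_leq (esym opt2)).
  have cIJ : #|I| = #|J| by rewrite cI cJ.
  have JB := flip_maximizers (pF _ B1F) (pF _ B2F) I1 J2 cIJ presI presJ o1 o2.
  rewrite inE cJ eqxx andbT; apply/fintype.subsetP => u uJ.
  by rewrite inE (fintype.subsetP JB) ?presJ.
rewrite mulnC (leq_trans (leq_mul lower (leqnn _))) // (leq_trans (leq_mul upper (leqnn
  _))) //.
by rewrite -mulnA [_ * #|W|.+1]mulnC mulnA [_ * 'C(_,
  _)]mulnC leq_mul // mulnC card_record // => S /hF[].
Qed.

(** * Graphs whose edges are evenly spread *)

(** On average [S] spans [#|S| * #|S|.-1 / 4] edges. With [L] of the order of
    [sqrt (K log n)], the deviation [6 * K * L] exceeds the fluctuations by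
    enough to survive a union bound over the [n ^ O(K)] sets [S]. *)
Definition balanced n (K L : nat) (Z : graph n) : bool :=
  [forall S : {set 'I_n}, (#|S| <= 3 * K) ==>
    (#|S| * #|S|.-1 <= 4 * edges Z S + 24 * K * L) &&
    (4 * edges Z S <= #|S| * #|S|.-1 + 24 * K * L)].

Lemma balancedP n (K L : nat) (Z : graph n) (S : {set 'I_n}) :
  balanced K L Z -> #|S| <= 3 * K ->
  #|S| * #|S|.-1 <= 4 * edges Z S + 24 * K * L /\
  4 * edges Z S <= #|S| * #|S|.-1 + 24 * K * L.
Proof. by move=> /forallP/(_ S)/implyP h /h /andP. Qed.

Lemma ordered_pairs r c :
  (r + c) * (r + c).-1 + r * r.-1 = c * c.-1 + 2 * r * (r + c).-1.
Proof.
have h x : x * x.-1 + x = x * x by case: x => // x; rewrite -mulnSr.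
have h1 : r * (r + c).-1 + r = r * (r + c).
  by case: (posnP r) => [-> //|r0]; rewrite -mulnSr prednK // addn_gt0 r0.
have := h r; have := h c; have := h (r + c).
move: h1; rewrite -mulnA; move: ((r + c) * _) (r * r.-1) (c * c.-1) (r * (r + c).-1).
by move=> *; lia.
Qed.

(** The edges inside [R] are counted twice by the left-hand sum. *)
Lemma sum_deg_sub n (Z : graph n) (R S : {set 'I_n}) : R \subset S ->
  \sum_(v in R) deg Z v S + edges Z (S :\: R) = edges Z S + edges Z R.
Proof.
move=> RS.
have split (F : 'I_n -> nat) : \sum_(v in S) F v = \sum_(v in R) F v + \sum_(v in S :\:
  R) F v.
  rewrite (big_setID R) /=; congr (_ + _); apply: eq_bigl => v; rewrite !inE //.
  by apply: andb_idl; apply: (fintype.subsetP RS).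
have dS v : deg Z v S = deg Z v R + deg Z v (S :\: R) by exact: split.
have e1 := sum_deg Z S; have e2 := sum_deg Z R; have e3 := sum_deg Z (S :\: R).
have e4 : \sum_(v in S :\: R) deg Z v S = \sum_(v in S :\: R) deg Z v R + (edges Z (S
  :\: R)).*2.
  by rewrite -e3 -big_split; apply: eq_bigr => v _; rewrite dS.
have e5 : \sum_(v in R) deg Z v S = (edges Z R).*2 + \sum_(v in R) deg Z v (S :\: R).
  by rewrite -e2 -big_split; apply: eq_bigr => v _; rewrite dS.
have e6 : \sum_(v in R) deg Z v (S :\: R) = \sum_(v in S :\: R) deg Z v R.
  rewrite /deg exchange_big /=; apply: eq_bigr => u _; apply: eq_bigr => v _.
  by rewrite adj_sym.
move: e1; rewrite split; lia.
Qed.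

(** The degrees into [S] of the vertices of a large part of [S] average to half
    the size of [S], up to [O(L)]. *)
Lemma balanced_low_deg n (K L : nat) (Z : graph n) (R S : {set 'I_n}) :
  balanced K L Z -> 0 < K -> R \subset S -> #|S| <= 3 * K -> K <= 2 * #|R| ->
  exists2 v, v \in R & 2 * deg Z v S <= #|S| + 72 * L.
Proof.
move=> bal K0 RS cS cR; apply/exists_inP; apply: contraT => /exists_inPn h.
have [_ b1] := balancedP bal cS.
have cRS := subset_leq_card RS.
have [_ b2] := balancedP bal (leq_trans cRS cS).
have cD : #|S :\: R| = #|S| - #|R| by rewrite cardsD (finset.setIidPr RS).
have [b3 _] := balancedP bal (leq_trans (subset_leq_card (finset.subsetDl S R)) cS).
have e := sum_deg_sub Z RS.
have : #|R| * (#|S| + 72 * L).+1 <= 2 * \sum_(v in R) deg Z v S.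
  by rewrite big_distrr /= -sum_nat_const; apply: leq_sum => v /h; rewrite -ltnNge.
rewrite cD in b3.
move: (#|R|) (#|S|) (edges Z S) (edges Z R) (edges Z (S :\: R)) (\sum_(v in R) _)
  cS cR cRS b1 b2 b3 e => r a e1 e2 e3 X cS cR cRS b1 b2 b3 e h1.
have h2 : a * a.-1 + r * r.-1 = (a - r) * (a - r).-1 + 2 * r * a.-1.
  by have := ordered_pairs r (a - r); rewrite subnKC.
have h3 : K * (72 * L).+1 <= 2 * r * (72 * L).+1 by rewrite leq_mul2r cR orbT.
have h4 : r * a.-1 <= r * a by rewrite leq_mul2l leq_pred orbT.
move: (a * a.-1) (r * r.-1) ((a - r) * _) (r * a.-1) b1 b2 b3 h2 h4 => A1 A2 A3 A4; lia.
Qed.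

(** The edges between [R] and [S] are those of [R :|: S] minus those of [R] and
    of [S], so [balanced] makes their number at least the mean, up to [O(K L)]. *)
Lemma balanced_high_deg n (K L : nat) (Z : graph n) (R S : {set 'I_n}) :
  balanced K L Z -> 0 < K -> [disjoint R & S] -> #|R| + #|S| <= 3 * K ->
  K <= 2 * #|R| ->
  exists2 v, v \in R & #|S| <= 2 * deg Z v S + 72 * L.
Proof.
move=> bal K0 dRS cRS cR; apply/exists_inP; apply: contraT => /exists_inPn h.
have cU : #|R :|: S| = #|R| + #|S| by apply/eqP; rewrite (leq_card_setU R S).
have cRS' : #|R :|: S| <= 3 * K by rewrite cU.
have [b1 _] := balancedP bal cRS'.
have [_ b2] := balancedP bal (leq_trans (leq_addr _ _) cRS).
have [_ b3] := balancedP bal (leq_trans (leq_addl _ _) cRS).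
have := sum_deg_sub Z (finset.subsetUl R S).
rewrite finset.setDUl finset.setDv finset.set0U (finset.setDidPl _) 1?disjoint_sym //.
have -> : \sum_(v in R) deg Z v (R :|: S) = (edges Z R).*2 + \sum_(v in R) deg Z v S.
  rewrite -sum_deg -big_split /=; apply: eq_bigr => v _.
  by rewrite /deg -bigU //=; apply: eq_bigl => u; rewrite !inE.
have : 2 * \sum_(v in R) deg Z v S + #|R| * (72 * L).+1 <= #|R| * #|S|.
  rewrite big_distrr /= -!sum_nat_const -big_split /=; apply: leq_sum => v /h.
  by rewrite -ltnNge -addnS addnC.
rewrite cU in b1.
move: (#|R|) (#|S|) (edges Z _) (edges Z S) (edges Z (R :|: S)) (\sum_(v in R) _)
  cRS cR b1 b2 b3 => r a e1 e2 e3 X cRS cR b1 b2 b3 h1 h2.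
have h4 : (r + a) * (r + a).-1 = r * r.-1 + a * a.-1 + 2 * r * a.
  have e := ordered_pairs r a.
  have h1' : r * (r + a).-1 + r = r * (r + a).
    by case: (posnP r) => [-> //|r0]; rewrite -mulnSr prednK // addn_gt0 r0.
  have hx x : x * x.-1 + x = x * x by case: x => // x; rewrite -mulnSr.
  have := hx r.
  move: e h1'; rewrite -!mulnA; move: ((r + a) * _) (r * r.-1) (a * a.-1) (r * (r +
    a).-1).
  by move=> *; lia.
have h3 : K * (72 * L).+1 <= 2 * r * (72 * L).+1 by rewrite leq_mul2r cR orbT.
move: ((r + a) * _) (r * r.-1) (a * a.-1) b1 b2 b3 h4 => A1 A2 A3; lia.
Qed.

(** The vertex is sought in the larger of [S :&: P] and [S :\: P], so that
    its removal leaves at least [j] vertices of [P]. *)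
Lemma balanced_remove n (K L : nat) (Z : graph n) (P S : {set 'I_n}) j a :
  balanced K L Z -> #|S| = a.+1 -> K <= a.+1 <= 3 * K -> 2 * j.+1 <= K ->
  j <= #|S :&: P| ->
  exists2 T : {set 'I_n}, T \subset S &
    [/\ #|T| = a, j <= #|T :&: P| & 2 * edges Z S <= 2 * edges Z T + a.+1 + 72 * L].
Proof.
move=> bal cS /andP[Ka aK] jK jS.
have K0 : 0 < K by apply: leq_trans jK; rewrite mul2n.
have aK' : #|S| <= 3 * K by rewrite cS.
have cID := cardsID P S; rewrite cS in cID.
have [big|small] := leqP a.+1 (2 * #|S :&: P|).
  have [v vR dv] := balanced_low_deg bal K0 (finset.subsetIl S P) aK' (leq_trans Ka big).
  have /andP[vS vP] : (v \in S) && (v \in P) by rewrite -finset.in_setI.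
  exists (S :\ v); first exact: finset.subD1set.
  split; first by have := cardsD1 v S; rewrite vS cS => -[].
    have -> : (S :\ v) :&: P = (S :&: P) :\ v by rewrite finset.setIDAC.
    by have := cardsD1 v (S :&: P); rewrite vR; lia.
  by rewrite (edges_rem Z vS); lia.
have hD : K <= 2 * #|S :\: P| by lia.
have [v vR dv] := balanced_low_deg bal K0 (finset.subsetDl S P) aK' hD.
have /andP[vP vS] : (v \notin P) && (v \in S) by rewrite -finset.in_setD.
exists (S :\ v); first exact: finset.subD1set.
split; first by have := cardsD1 v S; rewrite vS cS => -[].
  suff -> : (S :\ v) :&: P = S :&: P by [].
  by apply/setP => u; rewrite !inE; case: eqVneq => // ->; rewrite (negPf vP) !andbF.
by rewrite (edges_rem Z vS); lia.
Qed.

Lemma balanced_remove3 n (K L : nat) (Z : graph n) (P S : {set 'I_n}) j k :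
  balanced K L Z -> #|S| = k.+3 -> K <= k.+1 -> k.+3 <= 3 * K -> 2 * j.+1 <= K ->
  j <= #|S :&: P| ->
  exists2 T : {set 'I_n}, T \subset S &
    [/\ #|T| = k, j <= #|T :&: P| &
        2 * edges Z S <= 2 * edges Z T + 3 * k + 6 + 216 * L].
Proof.
move=> bal c0 Kk kK jK j0.
have h1 : K <= k.+3 <= 3 * K by lia.
have [T1 s1 [c1 j1 e1]] := balanced_remove bal c0 h1 jK j0.
have h2 : K <= k.+2 <= 3 * K by lia.
have [T2 s2 [c2 j2 e2]] := balanced_remove bal c1 h2 jK j1.
have h3 : K <= k.+1 <= 3 * K by lia.
have [T3 s3 [c3 j3 e3]] := balanced_remove bal c2 h3 jK j2.
exists T3; first by apply: fintype.subset_trans s3 (fintype.subset_trans s2 s1).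
by split => //; lia.
Qed.

(** * Three rows with a prescribed majority *)

Definition quartet n (p w1 w2 w3 : 'I_n) : {set 'I_n} := [set p; w1; w2; w3].

(** The bits [y] and [z] of [w2] and [w3] code which of the three new rows, if
    any, is to differ from the row [x] of [p], so that [x] is the majority of the
    three; [b] and [c] translate the code. Storing the old row of [w1] at [p]
    makes the recoding injective. *)
Definition recode_row n (Z : graph n) (p w1 w2 w3 : 'I_n) (b c : bool)
    (a u : 'I_n) : bool :=
  let x := adj Z p u in
  let y := adj Z w2 u (+) b in
  let z := adj Z w3 u (+) c in
  if a == p then adj Z w1 u
  else if a == w1 then x (+) (y && ~~ z)
  else if a == w2 then x (+) (~~ y && z)
  else x (+) (y && z).

Definition recode n (p w1 w2 w3 : 'I_n) (b c : bool) (Z : graph n) : graph n :=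
  of_adj (fun u v =>
    if (u \in quartet p w1 w2 w3) && (v \notin quartet p w1 w2 w3)
    then recode_row Z p w1 w2 w3 b c u v
    else if (v \in quartet p w1 w2 w3) && (u \notin quartet p w1 w2 w3)
    then recode_row Z p w1 w2 w3 b c v u
    else adj Z u v).

Lemma adj_recode n (p w1 w2 w3 : 'I_n) b c (Z : graph n) u v : u != v ->
  adj (recode p w1 w2 w3 b c Z) u v =
    if (u \in quartet p w1 w2 w3) && (v \notin quartet p w1 w2 w3)
    then recode_row Z p w1 w2 w3 b c u v
    else if (v \in quartet p w1 w2 w3) && (u \notin quartet p w1 w2 w3)
    then recode_row Z p w1 w2 w3 b c v u
    else adj Z u v.
Proof.
move=> ne; rewrite adj_of_adj // => x y; rewrite adj_sym.
by case: (x \in _); case: (y \in _).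
Qed.

Lemma adj_recode_row n (p w1 w2 w3 : 'I_n) b c (Z : graph n) a u :
  a \in quartet p w1 w2 w3 -> u \notin quartet p w1 w2 w3 ->
  adj (recode p w1 w2 w3 b c Z) a u = recode_row Z p w1 w2 w3 b c a u.
Proof.
move=> aQ uQ; rewrite adj_recode ?aQ ?uQ //.
by apply: contraNneq uQ => <-.
Qed.

Lemma edges_recode n (p w1 w2 w3 : 'I_n) b c (Z : graph n) (S : {set 'I_n}) :
  [disjoint S & quartet p w1 w2 w3] ->
  edges (recode p w1 w2 w3 b c Z) S = edges Z S.
Proof.
move=> dS; apply: edges_adj => u v uS vS.
have [->|ne] := eqVneq u v; first by rewrite !adj_irr.
by rewrite adj_recode // (disjointFr dS uS) (disjointFr dS vS).
Qed.

Lemma recode_inj n (p w1 w2 w3 : 'I_n) b c : uniq [:: p; w1; w2; w3] ->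
  injective (recode p w1 w2 w3 b c).
Proof.
move=> uq Z Z' e; set Q := quartet p w1 w2 w3.
have inside_out u v : u \in Q -> v \notin Q -> adj Z u v = adj Z' u v.
  move=> uQ vQ.
  have row a : a \in Q -> recode_row Z p w1 w2 w3 b c a v = recode_row Z' p w1 w2 w3 b
    c a v.
    by move=> aQ; rewrite -!adj_recode_row // e.
  have := row p; have := row w1; have := row w2; have := row w3.
  move: uq; rewrite /= !inE !negb_or -!andbA andbT => /and5P[n1 n2 n3 n4 /andP[n5 n6]].
  rewrite /recode_row !eqxx !orbT !(eq_sym _ p) (negPf n1) (negPf n2) (negPf n3).
  rewrite !(eq_sym _ w1) (negPf n4) (negPf n5) (eq_sym w3) (negPf n6) /=.
  move=> /(_ isT) h3 /(_ isT) h2 /(_ isT) h1 /(_ isT) h0.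
  have [hp [hw2 hw3]] : adj Z p v = adj Z' p v /\ adj Z w2 v = adj Z' w2 v /\ adj Z w3
    v = adj Z' w3 v.
    move: h1 h2 h3; clear.
    by case: b; case: c; case: (adj Z p v); case: (adj Z w2 v); case: (adj Z w3 v);
      case: (adj Z' p v); case: (adj Z' w2 v); case: (adj Z' w3 v).
  by move: uQ; rewrite !inE => /orP[/orP[/orP[]|]|] /eqP ->.
apply: graph_ext => u v ne.
have [uQ|uQ] := boolP (u \in Q); have [vQ|vQ] := boolP (v \in Q).
- have := congr1 (fun Y => adj Y u v) e.
  by rewrite /= !adj_recode // -/Q uQ vQ.
- exact: inside_out.
- by rewrite adj_sym [RHS]adj_sym; apply: inside_out.
- have := congr1 (fun Y => adj Y u v) e.
  by rewrite /= !adj_recode // -/Q (negPf uQ) (negPf vQ).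
Qed.

(** At each vertex exactly three of the four translated codes designate a row
    that differs from the row of [p]. Summed over the four translates, a vertex
    adjacent to [p] thus contributes [4 * 3 - 3 = 9], any other one [3], and at
    least one translate does as well as the average. *)
Lemma recode_gain n (p w1 w2 w3 : 'I_n) (Z : graph n) (S : {set 'I_n}) :
  uniq [:: p; w1; w2; w3] -> [disjoint S & quartet p w1 w2 w3] ->
  exists b c, 6 * deg Z p S + 3 * #|S| <=
    4 * (deg (recode p w1 w2 w3 b c Z) w1 S + deg (recode p w1 w2 w3 b c Z) w2 S
         + deg (recode p w1 w2 w3 b c Z) w3 S).
Proof.
move=> uq dS.
pose N b c := deg (recode p w1 w2 w3 b c Z) w1 S + deg (recode p w1 w2 w3 b c Z) w2 S
         + deg (recode p w1 w2 w3 b c Z) w3 S.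
suff : N false false + N false true + N true false + N true true =
       6 * deg Z p S + 3 * #|S|.
  move=> e; have [h|h1] := leqP (6 * deg Z p S + 3 * #|S|) (4 * N false false).
    by exists false, false.
  have [h|h2] := leqP (6 * deg Z p S + 3 * #|S|) (4 * N false true).
    by exists false, true.
  have [h|h3] := leqP (6 * deg Z p S + 3 * #|S|) (4 * N true false).
    by exists true, false.
  by exists true, true; rewrite -/(N true true); lia.
rewrite /N /deg -sum1_card !big_distrr /= -!big_split /=; apply: eq_bigr => u uS.
have uQ : u \notin quartet p w1 w2 w3 by rewrite (disjointFr dS uS).
rewrite !adj_recode_row // ?inE ?eqxx ?orbT //.
move: uq; rewrite /= !inE !negb_or -!andbA andbT => /and5P[n1 n2 n3 n4 /andP[n5 n6]].
rewrite /recode_row !eqxx !(eq_sym _ p) (negPf n1) (negPf n2) (negPf n3).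
rewrite !(eq_sym _ w1) (negPf n4) (negPf n5) (eq_sym w3) (negPf n6) /=.
by case: (adj Z p u); case: (adj Z w2 u); case: (adj Z w3 u).
Qed.

Definition unsteady n (P W : {set 'I_n}) (k j L : nat) (p : 'I_n) :
    {set graph n} :=
  [set Z | [exists S in fam P k j (p |: W),
    [&& edges Z S + deg Z p S == reach Z (fam P k j (p |: W)) p,
        k + 600 * L < 2 * deg Z p S &
        2 * dens Z P k j (p |: W) + k
          <= 2 * reach Z (fam P k j (p |: W)) p + 72 * L]]].

(** Suppose that [p] sends [k / 2 + x] edges to a maximizer [S], with [x] much
    larger than [L]. Recoding turns this into [3 * k / 2 + 3 * x / 2] edges from
    [w1], [w2] and [w3] to [S], while removing any three vertices of low degree
    costs only [3 * k / 2 + O(L)] edges. As [S] itself spans at least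
    [dens - x - O(L)] edges, the set obtained beats [dens] by about [x / 2]. So
    three given vertices would matter to the maximum, which is rare by
    [card_essential]. *)
Lemma card_unsteady n (K L : nat) (P W : {set 'I_n}) (p w1 w2 w3 : 'I_n)
    (j k : nat) :
  K = k.+1 -> 0 < L -> 2 * j.+1 <= K -> 2 <= K ->
  p \notin W -> uniq [:: w1; w2; w3] -> w1 \in W -> w2 \in W -> w3 \in W ->
  #|unsteady P W k j L p| <=
    4 * (#|[set Z : graph n | ~~ balanced K L Z]| +
         #|[set Z | dens Z P k j (p |: W) <
                    dens Z P k j ((p |: W) :\: [set w1; w2; w3])]|).
Proof.
move=> eK L0 jK K2 pW uw w1W w2W w3W.
set Bd := unsteady P W k j L p.
set G := #|_| + #|_|.
pose G' := [set Z : graph n | ~~ balanced K L Z] :|: [set Z | dens Z P k j (p |: W) <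
  dens Z P k j ((p |: W) :\: [set w1; w2; w3])].
have cG : #|G'| <= G by rewrite /G -cardsUI leq_addr.
have uq : uniq [:: p; w1; w2; w3].
  rewrite cons_uniq uw andbT !inE !negb_or.
  by apply/and3P; split; apply: contraNneq pW => ->.
have dQ (S : {set 'I_n}) : [disjoint S & p |: W] -> [disjoint S & quartet p w1 w2 w3].
  move=> dS; rewrite disjoint_sym; apply: disjointWl (_ : quartet p w1 w2 w3 \subset p
    |: W) _; last by rewrite disjoint_sym.
  by apply/fintype.subsetP => u; rewrite !inE => /orP[/orP[/orP[]|]|] /eqP ->;
    rewrite ?eqxx ?w1W ?w2W ?w3W ?orbT.
have cover : Bd \subset \bigcup_(bc : bool * bool) (recode p w1 w2 w3 bc.1 bc.2 @^-1: G').
  apply/fintype.subsetP => Z; rewrite inE => /exists_inP[S SF /and3P[/eqP e1 e2 e3]].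
  have dS : [disjoint S & p |: W] by move: SF; rewrite inE => /and3P[].
  have cS : #|S| = k by move: SF; rewrite inE => /and3P[/eqP].
  have jS : j <= #|S :&: P| by move: SF; rewrite inE => /and3P[].
  have [b [c h]] := recode_gain Z uq (dQ _ dS).
  apply/bigcupP; exists (b, c) => //; rewrite !inE /=.
  set Z' := recode _ _ _ _ _ _ _ in h *.
  case: (boolP (balanced K L Z')) => //= bal.
  have eD : dens Z' P k j (p |: W) = dens Z P k j (p |: W).
    apply: eq_bigr => T; rewrite inE => /and3P[_ _ dT].
    by rewrite edges_recode // dQ.
  have ewS v : v \in W -> v \notin S by move=> vW;
    rewrite (disjointFl dS) // !inE vW orbT.
  have [n1 n2 n3] : [/\ w1 != w2, w1 != w3 & w2 != w3].
    by move: uw; rewrite /= !inE negb_or andbT => /andP[/andP[-> ->] ->].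
  pose S3 := w3 |: (w2 |: (w1 |: S)).
  have m2 : w2 \notin w1 |: S by rewrite !inE negb_or eq_sym n1 ewS.
  have m3 : w3 \notin w2 |: (w1 |: S) by rewrite !inE !negb_or eq_sym n3 eq_sym n2 ewS.
  have cS3 : #|S3| = k.+3 by rewrite !cardsU1 m3 m2 ewS // cS.
  have degS v (A B : {set 'I_n}) : A \subset B -> deg Z' v A <= deg Z' v B.
    by move=> AB; rewrite /deg [leqRHS](big_setID A) /= (finset.setIidPr AB) leq_addr.
  have eS3 : edges Z' S + (deg Z' w1 S + deg Z' w2 S + deg Z' w3 S) <= edges Z' S3.
    rewrite /S3 !edges_add ?ewS // !addnA leq_add ?leq_add //.
      by apply: degS; apply: finset.subsetUr.
    by apply: degS; rewrite finset.setUA; apply: finset.subsetUr.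
  have jS3 : j <= #|S3 :&: P|.
    apply: leq_trans jS _; apply: subset_leq_card; apply: finset.setSI.
    by rewrite /S3 !finset.setUA; apply: finset.subsetUr.
  have hk1 : K <= k.+1 by rewrite eK.
  have hk3 : k.+3 <= 3 * K by clear -eK K2; lia.
  have [T TS [cT jT eT]] := balanced_remove3 bal cS3 hk1 hk3 jK jS3.
  have TF : T \in fam P k j ((p |: W) :\: [set w1; w2; w3]).
    rewrite inE cT eqxx jT /= finset.disjoints_subset.
    apply/fintype.subsetP => u /(fintype.subsetP TS); rewrite !inE.
    case: (boolP (u == w1)) => //= u1; case: (boolP (u == w2)) => //= u2.
    case: (boolP (u == w3)) => //= u3 uS.
    by have := disjointFr dS uS; rewrite !inE => ->.
  have := dens_ge Z' TF; rewrite eD.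
  have eSS : edges Z' S = edges Z S by rewrite edges_recode // dQ.
  rewrite cS in h; rewrite eSS in eS3.
  clear - h eS3 eT e1 e2 e3 L0; lia.
apply: leq_trans (subset_leq_card cover) _.
apply: leq_trans (card_bigcup_le _ _) _.
apply: (@leq_trans (\sum_(bc : bool * bool) G)); last first.
  by rewrite sum_nat_const card_prod card_bool.
apply: leq_sum => -[b c] _; apply: leq_trans cG; rewrite /=.
have inj := @recode_inj n p w1 w2 w3 b c uq.
rewrite -(card_imset _ inj) subset_leq_card //.
by apply/fintype.subsetP => Z /imsetP[Y]; rewrite inE => h ->.
Qed.

(** * Trading a vertex of the clique for a vertex of the reservoir *)

Lemma fam_add n (P X Y S : {set 'I_n}) k j i v :
  S \in fam P k j Y -> v \notin S -> v \notin X -> X \subset Y ->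
  i <= (v \in P) + #|S :&: P| -> v |: S \in fam P k.+1 i X.
Proof.
rewrite !inE => /and3P[/eqP cS jS dS] vS vX XY hi.
rewrite cardsU1 vS cS eqxx /=; apply/andP; split.
  apply: leq_trans hi _; case: (boolP (v \in P)) => vP; last first.
    by rewrite add0n subset_leq_card // finset.setSI // finset.subsetUr.
  have -> : (v |: S) :&: P = v |: (S :&: P).
    by apply/setP => u; rewrite !inE andb_orl; case: eqVneq => //= ->; rewrite vP.
  by rewrite cardsU1 !inE (negPf vS).
rewrite disjoint_sym disjoint_setU1r vX disjoint_sym.
by rewrite disjoint_sym (disjointWl XY) // disjoint_sym.
Qed.

(** Off the exceptional events, [p] is replaced by the vertex [w] of the
    reservoir that does best with some other set of the family of [p]: the
    result has one vertex less in [P] and at least [t] edges more. *)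
Lemma dens_step n (K L k j t : nat) (P W : {set 'I_n}) (Z : graph n) :
  K = k.+1 -> #|P| = K -> [disjoint W & P] -> 2 * j.+1 <= K ->
  2 * K + #|W| <= n ->
  balanced K L Z ->
  dens Z P K j.+1 finset.set0 <= dens Z P K j.+1 W ->
  {in P, forall p,
     Z \notin near_record (fam P k j (p |: W)) W (k + 600 * L)./2 t p} ->
  {in P, forall p, Z \notin unsteady P W k j L p} ->
  dens Z P K j.+1 finset.set0 + t <= dens Z P K j finset.set0.
Proof.
move=> eK cP dWP jK Kn bal hW hnear hsteady.
have K0 : 0 < K by rewrite eK.
apply: leq_trans (leq_add hW (leqnn t)) _.
have PF : P \in fam P K j.+1 W.
  by rewrite inE cP eqxx finset.setIid cP disjoint_sym dWP andbT /=; clear -jK; lia.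
have [|Q QF eQ] := @dens_attained _ Z P K j.+1 W; first by apply/set0Pn; exists P.
have /and3P[/eqP cQ jQ dQ] : [&& #|Q| == K, j.+1
  <= #|Q :&: P| & [disjoint Q & W]] by move: QF; rewrite inE.
have /card_gt0P[p] : 0 < #|Q :&: P| by apply: leq_trans jQ.
rewrite finset.in_setI => /andP[pQ pP].
have pW : p \notin W by rewrite (disjointFl dWP pP).
set F := fam P k j (p |: W).
have SF : Q :\ p \in F.
  rewrite inE; apply/and3P; split.
  - by have := cardsD1 p Q; rewrite pQ cQ eK add1n => -[<-].
  - have -> : (Q :\ p) :&: P = (Q :&: P) :\ p by rewrite finset.setIDAC.
    by have := cardsD1 p (Q :&: P); rewrite finset.in_setI pQ pP add1n => h;
      rewrite -ltnS -h.
  - rewrite disjoint_setU1r !inE eqxx /=.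
    by apply: disjointWl dQ; apply: finset.subD1set.
have eS : edges Z (Q :\ p) + deg Z p (Q :\ p) = dens Z P K j.+1 W.
  by rewrite -eQ -edges_add ?finset.setD1K // !inE eqxx.
have FW S v : S \in F -> v \in p |: W -> v \notin S.
  by rewrite inE => /and3P[_ _ dS] vW; rewrite (disjointFl dS).
have eR : reach Z F p = dens Z P K j.+1 W.
  apply/eqP; rewrite eqn_leq -{2}eS reach_ge // andbT.
  apply/bigmax_leqP => S hS; have pS : p \notin S by apply: (FW _ _ hS);
    rewrite !inE eqxx.
  rewrite -edges_add // eK; apply: dens_ge.
  apply: (fam_add hS pS pW (finset.subsetUr _ _)).
  by rewrite pP add1n ltnS; move: hS; rewrite inE => /and3P[].
have lowR : 2 * dens Z P k j (p |: W) + k <= 2 * reach Z F p + 72 * L.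
  rewrite eR.
  have P'F : P :\ p \in fam P k j W.
    rewrite inE; apply/and3P; split.
    - by have := cardsD1 p P; rewrite pP cP eK add1n => -[<-].
    - rewrite (finset.setIidPl (finset.subD1set _ _)).
      by have := cardsD1 p P; rewrite pP cP /= => h; clear -h jK; lia.
    - rewrite disjoint_sym; apply: disjointWr dWP; apply: finset.subD1set.
  have [|S0 S0F eS0] := @dens_attained _ Z P k j W; first by apply/set0Pn;
    exists (P :\ p).
  have /and3P[/eqP cS0 jS0 dS0] : [&& #|S0| == k, j
    <= #|S0 :&: P| & [disjoint S0 & W]] by move: S0F; rewrite inE.
  have mono : dens Z P k j (p |: W) <= dens Z P k j W.
    by apply: dens_mono => //; apply: finset.subsetUr.
  (* A vertex of high degree to [S0] is sought in [P] if the overlap of [S0]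
     still has to grow, and anywhere otherwise. *)
  have [R [cR RS0 RW hR]] : exists R : {set 'I_n}, [/\ K <= 2 * #|R| <= 2 * K,
    [disjoint R & S0],
      [disjoint R & W] & forall v, v \in R -> j.+1 <= (v \in P) + #|S0 :&: P|].
    have [big|small] := leqP j.+1 #|S0 :&: P|.
      have : K <= #|~: (S0 :|: W)|.
        have := cardsC (S0 :|: W); rewrite card_ord.
        have := leq_card_setU S0 W; rewrite /leqif cS0 => -[h1 _] h2.
        by clear - h1 h2 Kn eK; lia.
      move=> /exists_subset_card[R sub cR]; exists R; rewrite cR; split.
      - by clear; lia.
      - by rewrite finset.disjoints_subset (fintype.subset_trans sub) //
                   finset.setCS finset.subsetUl.
      - by rewrite finset.disjoints_subset (fintype.subset_trans sub) //
                   finset.setCS finset.subsetUr.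
      - by move=> v _; apply: leq_trans big (leq_addl _ _).
    exists (P :\: S0); split.
    - have := cardsID S0 P; rewrite cP finset.setIC => h.
      by clear -h small jK; lia.
    - by rewrite finset.disjoints_subset finset.setDE finset.subsetIr.
    - rewrite disjoint_sym; apply: disjointWr dWP; apply: finset.subsetDl.
    - by move=> v; rewrite inE => /andP[_ ->].
  have cRS : #|R| + #|S0| <= 3 * K by rewrite cS0; clear - cR eK; lia.
  have /andP[cR1 _] := cR.
  have [v vR] := balanced_high_deg bal K0 RS0 cRS cR1.
  rewrite cS0 => dv.
  have vF : v |: S0 \in fam P K j.+1 W.
    rewrite eK; apply: (fam_add S0F); rewrite ?(disjointFr RS0 vR) ?(disjointFr RW vR) //.
    exact: hR.
  have := dens_ge Z vF; rewrite edges_add ?(disjointFr RS0 vR) // eS0 => h.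
  by clear - h dv mono; lia.
have dD : deg Z p (Q :\ p) <= (k + 600 * L)./2.
  have := hsteady p pP; rewrite inE => /exists_inPn/(_ _ SF).
  rewrite -/F eS eR eqxx /= -eR lowR andbT -leqNgt => h.
  by rewrite geq_half_double -mul2n.
have := hnear p pP; rewrite inE => /exists_inPn/(_ _ SF).
rewrite -/F eS eR eqxx dD /= => /forall_inPn[w wW]; rewrite -leqNgt => hw.
apply: leq_trans hw _; apply/bigmax_leqP => S hS.
have wS : w \notin S by apply: (FW _ _ hS); rewrite !inE wW orbT.
rewrite -edges_add // eK; apply: dens_ge.
apply: (fam_add hS wS _ (finset.sub0set _)); first by rewrite inE.
by apply: leq_trans (leq_addl _ _); move: hS; rewrite inE => /and3P[].
Qed.

(** * The planted law as the image of the uniform law *)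

Local Open Scope ring_scope.

Definition plant n (K : nat) (Z : graph n) : graph n :=
  [ffun p => inside (PC n K) p || Z p].

(** Edge by edge, a fair bit forced to [1] inside the clique has the law
    prescribed by [planted_pmf]. *)
Lemma planted_probE (R : realType) n K (E : graph n -> Prop) :
  planted_prob R K E =
    #|[set Z : graph n | `[< E (plant K Z) >]]|%:R / #|{: graph n}|%:R.
Proof.
have pmfE Z' : planted_pmf R K Z' =
    \sum_(Z : graph n) (plant K Z == Z')%:R / #|{: graph n}|%:R.
  rewrite /planted_pmf.
  transitivity (\prod_(p : vpair n) \sum_(b : bool)
     ((inside (PC n K) p || b) == Z' p)%:R / (2 : R)).
    apply: eq_bigr => p _; rewrite big_bool /= orbT orbF /bernoulli_pmf.
    by case: (inside _ p); case: (Z' p) => /=; rewrite ?subrr ?mul0r ?addr0 ?add0r; lra.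
  rewrite bigA_distr_bigA /=; apply: eq_bigr => Z _.
  rewrite big_split /= prodr_const; congr (_ * _).
    have [e|ne] := eqVneq (plant K Z) Z'.
      by rewrite big1 // => p _; rewrite -e ffunE eqxx.
    have [p hp] : exists p, plant K Z p != Z' p.
      by apply/existsP; apply: contraNT ne; rewrite negb_exists => /forallP h;
         apply/eqP/ffunP => p; apply/eqP; have := h p; rewrite negbK.
    rewrite (bigD1 p) //= -[X in _ == X](_ : Z' p = _) //.
    by rewrite ffunE in hp; rewrite (negPf hp) mul0r.
  by rewrite card_ffun card_bool natrX exprVn.
rewrite /planted_prob; under eq_bigr do rewrite pmfE.
rewrite exchange_big /= -sum1dep_card natr_sum mulr_suml.
rewrite [RHS]big_mkcond /=; apply: eq_bigr => Z _.
under eq_bigr do rewrite mulrC.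
rewrite -big_distrr /=; case: ifP => [h|/negP h].
  rewrite (bigD1 (plant K Z)) //= eqxx big1 ?addr0 ?mulr1 ?mul1r // => Z' /andP[_].
  by rewrite eq_sym => /negPf ->.
rewrite big1 ?mulr0 // => Z' hZ'; case: eqVneq => // e.
by case: h; rewrite e.
Qed.

Lemma edges_plant n K (Z : graph n) (S : {set 'I_n}) :
  (edges (plant K Z) S + edges Z (S :&: PC n K) =
   edges Z S + \sum_(p : vpair n | inside (S :&: PC n K) p) 1)%N.
Proof.
have sub p : inside (S :&: PC n K) p = inside S p && inside (PC n K) p.
  by rewrite /inside !finset.in_setI; case: (_ \in S); case: (_ \in S);
    case: (_ \in PC _ _); rewrite ?andbF.
rewrite /edges (eq_bigl _ _ sub) [X in (_ + X)%N]big_mkcondr /=.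
rewrite [X in (_ = _ + X)%N](eq_bigl _ _ sub) [X in (_ = _ + X)%N]big_mkcondr /=.
rewrite -!big_split /=; apply: eq_bigr => p _; rewrite ffunE.
by case: (inside (PC n K) p); rewrite /= ?addn0 // addnC.
Qed.

(** * Deviations of edge counts *)

Lemma cosh_le (R : realType) (x : R) : 0 <= x <= 1 / 2 ->
  (expR x + expR (- x)) / 2 <= expR (3 / 2 * x ^+ 2).
Proof.
move=> /andP[x0 x1].
apply: le_trans (expR_ge1Dx _).
have h1 : expR (- x) <= 1 - x + x ^+ 2.
  rewrite expRN -[leLHS]mul1r ler_pdivrMr ?expR_gt0 //.
  have := expR_ge1Dx x => h.
  have q0 : 0 <= 1 - x + x ^+ 2 by have := sqr_ge0 x; lra.
  apply: le_trans (ler_wpM2l q0 h); have x3 : 0 <= x ^+ 3 by exact: exprn_ge0.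
  by rewrite (_ : _ * _ = 1 + x ^+ 3); [lra | ring].
have h2 : expR x <= 1 + x + 2 * x ^+ 2.
  have := expR_ge1Dx (- x); rewrite expRN => h.
  have e0 := expR_gt0 x.
  have h' : (1 - x) * expR x <= 1.
    by have := ler_wpM2r (ltW e0) h; rewrite mulVf ?gt_eqF.
  have h3 : 1 <= (1 - x) * (1 + x + 2 * x ^+ 2) by nra.
  have x2 : 0 < 1 - x by lra.
  by rewrite -(ler_pM2l x2); apply: le_trans h' h3.
lra.
Qed.

(** The exponential moment of the centred edge count factorizes over pairs. *)
Lemma sum_expR_edges (R : realType) n (S : {set 'I_n}) (x : R) :
  \sum_(Z : graph n) expR (x * (2 * (edges Z S)%:R - (\sum_(p : vpair n | inside S p)
    1)%:R))
  = #|{: graph n}|%:R * ((expR x + expR (- x)) / 2) ^+ (\sum_(p : vpair n | inside S p)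
    1).
Proof.
set N := (\sum_(p | _) 1)%N.
transitivity (\sum_(Z : graph n) \prod_(p : vpair n)
    (if inside S p then expR (if Z p then x else - x) else 1)).
  apply: eq_bigr => Z _; rewrite -big_mkcond /= -expR_sum; congr expR.
  rewrite /N /edges !natr_sum mulr_sumr -sumrB mulr_sumr; apply: eq_bigr => p _.
  by case: (Z p) => /=; rewrite ?mulr1n ?mulr0n; ring.
rewrite -(bigA_distr_bigA (fun p (b : bool) => if inside S p then expR (if b then x
  else - x) else 1)) /=.
transitivity (\prod_(p : vpair n) (2 * (if inside S p then (expR x + expR (- x)) / 2
  else 1))).
  by apply: eq_bigr => p _; rewrite big_bool /=; case: ifP => _; field.
rewrite big_split /= prodr_const -big_mkcond /= prodr_const card_ffun card_bool natrX.
by congr (_ * _ ^+ _); rewrite /N sum1_card.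
Qed.

(** Chernoff's bound with parameter [L / K]: the exponent is at most
    [- 12 * L ^ 2 + 3 / 2 * 9 / 2 * L ^ 2 <= - 5 * L ^ 2]. *)
Lemma card_deviation (R : realType) n (K L : nat) (S : {set 'I_n}) (s : bool) :
  (0 < K)%N -> (2 * L <= K)%N -> (#|S| <= 3 * K)%N ->
  #|[set Z : graph n | 12 * K%:R * L%:R <=
      (-1) ^+ s * (2 * (edges Z S)%:R - (\sum_(p : vpair n | inside S p) 1)%:R) :> R]|%:R
  <= expR (- (5 * L%:R ^+ 2)) * #|{: graph n}|%:R :> R.
Proof.
move=> K0 LK cS; set N := (\sum_(p | _) 1)%N; set A := [set Z | _].
pose x : R := L%:R / K%:R.
have K0' : 0 < K%:R :> R by rewrite ltr0n.
have L0 : 0 <= L%:R :> R by rewrite ler0n.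
have x01 : 0 <= x <= 1 / 2.
  rewrite divr_ge0 ?ler0n //= ler_pdivrMr // mulrC mulrA ler_pdivlMr // mulr1.
  by rewrite -natrM ler_nat mulnC.
have x0 : 0 <= x by case/andP: x01.
have NK : N%:R <= 9 / 2 * K%:R ^+ 2 :> R.
  have : (N.*2 <= (3 * K) * (3 * K))%N.
    by rewrite card_inside leq_mul // (leq_trans (leq_pred _)).
  by rewrite -(ler_nat R) -mul2n !natrM expr2; lra.
have e0 : 0 < expR (12 * L%:R ^+ 2) :> R by exact: expR_gt0.
rewrite -(ler_pM2l e0) [leRHS]mulrA -expRD.
apply: (@le_trans _ _ (#|{: graph n}|%:R * ((expR x + expR (- x)) / 2) ^+ N)); last first.
  rewrite [leRHS]mulrC; apply: ler_wpM2l => //.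
  have c0 : 0 <= (expR x + expR (- x)) / 2.
    by rewrite divr_ge0 // addr_ge0 // expR_ge0.
  apply: le_trans (lerXn2r N _ _ (cosh_le x01)) _; rewrite ?nnegrE ?expR_ge0 //.
  rewrite -expRM_natl ler_expR.
  have xK : x * K%:R = L%:R by rewrite mulfVK ?gt_eqF.
  have : (x * K%:R) ^+ 2 = L%:R ^+ 2 by rewrite xK.
  rewrite exprMn => xx; have x2 : 0 <= 3 / 2 * x ^+ 2 by have := sqr_ge0 x; lra.
  apply: le_trans (ler_wpM2r x2 NK) _; have := sqr_ge0 (L%:R : R).
  rewrite (_ : 9 / 2 * K%:R ^+ 2 * (3 / 2 * x ^+ 2) = 27 / 4 * (x ^+ 2 * K%:R ^+ 2));
    last by field.
  by rewrite xx; lra.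
have -> : (expR x + expR (- x)) / 2 = (expR ((-1) ^+ s * x) + expR (- ((-1) ^+ s * x)))
  / 2.
  by case: (s); rewrite ?expr1 ?expr0 ?mulN1r ?mul1r ?opprK // addrC.
rewrite -sum_expR_edges -/N -sum1dep_card natr_sum mulr_sumr.
rewrite [leLHS]big_mkcond /=; apply: ler_sum => Z _.
case: ifP => [h|_]; last exact: expR_ge0.
rewrite mulr1 ler_expR.
have := ler_wpM2l x0 h.
rewrite (_ : x * (12 * K%:R * L%:R) = 12 * L%:R ^+ 2); last first.
  by rewrite /x; field; rewrite gt_eqF.
by move/le_trans; apply; rewrite mulrCA mulrA.
Qed.

Lemma card_unbalanced (R : realType) n (K L : nat) :
  (0 < K)%N -> (2 * L <= K)%N -> ((3 * K).+1 <= n)%N ->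
  #|[set Z : graph n | ~~ balanced K L Z]|%:R
  <= n%:R ^+ (3 * K).+1 * (2 * expR (- (5 * L%:R ^+ 2)) * #|{: graph n}|%:R) :> R.
Proof.
move=> K0 LK Kn.
pose A (S : {set 'I_n}) (s : bool) := [set Z : graph n | 12 * K%:R * L%:R <=
      (-1) ^+ s * (2 * (edges Z S)%:R - (\sum_(p : vpair n | inside S p) 1)%:R) :> R].
have cover : [set Z : graph n | ~~ balanced K L Z] \subset
    \bigcup_(S in [set S : {set 'I_n} | (#|S| <= 3 * K)%N]) (A S true :|: A S false).
  apply/fintype.subsetP => Z; rewrite inE negb_forall => /existsP[S].
  rewrite negb_imply => /andP[cS h]; apply/bigcupP; exists S; first by rewrite inE.
  have := card_inside S; set N := (\sum_(p | _) 1)%N => eN.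
  move: h; rewrite -eN negb_and -!ltnNge !inE -!natrM expr1 expr0 mulN1r mul1r -/N.
  case/orP => h; apply/orP; [left|right].
    rewrite opprB lerBrDr -natrD ler_nat; lia.
  by rewrite lerBrDr -natrD ler_nat; lia.
have h1 : (#|[set Z : graph n | ~~ balanced K L Z]| <=
   \sum_(S in [set S : {set 'I_n} | (#|S| <= 3 * K)%N]) (#|A S true| + #|A S false|))%N.
  apply: leq_trans (subset_leq_card cover) _.
  apply: leq_trans (card_bigcup_le _ _) _.
  by apply: leq_sum => S _; apply: leq_card_setU.
move: h1; rewrite -(ler_nat R) => h1; apply: le_trans h1 _.
rewrite natr_sum.
set c := 2 * _ * _; have c0 : 0 <= c by rewrite !mulr_ge0 ?expR_ge0.
apply: (@le_trans _ _ (\sum_(S in [set S : {set 'I_n} | (#|S| <= 3 * K)%N]) c)).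
  apply: ler_sum => S; rewrite inE => cS; rewrite natrD /c -mulrA mulr_natl mulr2n.
  by rewrite lerD // card_deviation.
rewrite sumr_const -[leLHS]mulr_natl ler_wpM2r // -natrX ler_nat.
exact: card_small_sets.
Qed.

(** * Probability that a trade fails *)

(** Union bound for [dens_step]: unbalanced graphs, graphs whose maximizers all
    meet the reservoir, and for each of the [K] vertices of [P] a near record or
    an excessive degree. *)
Lemma card_step_failure (R : realType) n (K L k j t N : nat) (P W : {set 'I_n}) (U x :
  R) :
  K = k.+1 -> #|P| = K -> [disjoint W & P] -> (2 * j.+1 <= K)%N -> (2 <= K)%N ->
  (0 < L)%N -> (2 * K + #|W| <= n)%N -> (3 <= #|W|)%N ->
  (0 < N)%N -> (N + K + #|W| <= n)%N ->
  #|[set Z : graph n | ~~ balanced K L Z]|%:R <= U * #|{: graph n}|%:R ->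
  0 < ('C(k - (k + 600 * L)./2, t)%:R : R) ->
  'C((k + 600 * L)./2 + t, t)%:R <= x * 'C(k - (k + 600 * L)./2, t)%:R ->
  #|[set Z : graph n | (dens Z P K j finset.set0 < dens Z P K j.+1 finset.set0 + t)%N]|%:R
  <= (U + #|W|%:R * K%:R / N%:R +
      K%:R * (x / #|W|.+1%:R + 4 * (U + 3 * k%:R / N%:R))) * #|{: graph n}|%:R.
Proof.
move=> eK cP dWP jK K2 L0 Kn W3 N0 Nn hU C0 hx.
set G : R := #|{: graph n}|%:R; set D := ((k + 600 * L)./2)%N in C0 hx.
pose B0 := [set Z : graph n | ~~ balanced K L Z].
pose B1 := [set Z : graph n | (dens Z P K j.+1 (W :|: finset.set0) < dens Z P K j.+1
  finset.set0)%N].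
have N0' : 0 < N%:R :> R by rewrite ltr0n.
have cPW : (N <= #|~: (P :|: (W :|: finset.set0))|)%N.
  rewrite finset.setU0; have := cardsC (P :|: W); rewrite card_ord.
  have := leq_card_setU P W; rewrite /leqif => -[h1 _] h2.
  by clear -h1 h2 Nn cP; lia.
have hB1 : #|B1|%:R <= #|W|%:R * K%:R / N%:R * G.
  rewrite /G mulrAC ler_pdivlMr // mulrC -!natrM ler_nat.
  by apply: card_essential cPW; rewrite finset.setU0.
have near p : p \in P -> #|near_record (fam P k j (p |: W)) W D t p|%:R
  <= x / #|W|.+1%:R * G.
  move=> pP; have pW : p \notin W by rewrite (disjointFl dWP pP).
  have hF S : S \in fam P k j (p |: W) -> #|S| = k /\ [disjoint S & p |: W].
    by rewrite inE => /and3P[/eqP].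
  have := card_near_record D t pW hF; rewrite -(ler_nat R) !natrM => h.
  have W0 : 0 < #|W|.+1%:R :> R by rewrite ltr0n.
  rewrite mulrAC ler_pdivlMr // -(ler_pM2r C0).
  apply: le_trans (le_trans _ h) _; last first.
    by rewrite [leRHS]mulrAC ler_wpM2r // ler0n.
  by rewrite mulrAC mulrC.
have [w1 [w2 [w3 [uw w1W w2W w3W]]]] : exists w1 w2 w3,
    [/\ uniq [:: w1; w2; w3], w1 \in W, w2 \in W & w3 \in W].
  move: W3 => /card_geqP[s [us cs sW]].
  case: s us cs sW => [|w1 [|w2 [|w3 [|? ?]]]] //= us _ sW.
  by exists w1, w2, w3; split=> //; apply: sW; rewrite !inE eqxx ?orbT.
have steady p : p \in P -> #|unsteady P W k j L p|%:R <= 4 * (U + 3 * k%:R / N%:R) * G.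
  move=> pP; have pW : p \notin W by rewrite (disjointFl dWP pP).
  have := card_unsteady P eK L0 jK K2 pW uw w1W w2W w3W.
  rewrite -(ler_nat R) natrM natrD => h.
  apply: le_trans h _; rewrite -mulrA ler_wpM2l // mulrDl lerD //.
  set T3 := [set w1; w2; w3].
  have T3W : T3 \subset W.
    by apply/fintype.subsetP => u; rewrite !inE => /orP[/orP[]|] /eqP ->.
  have cT3 : #|T3| = 3%N.
    by rewrite -[RHS](card_uniqP uw); apply: eq_card => u; rewrite !inE orbA.
  have eT3 : p |: W = T3 :|: ((p |: W) :\: T3).
    apply/setP => u; rewrite [RHS]finset.in_setU [X in _ = _ || X]finset.in_setD.
    by case: (boolP (u \in T3)) => //= /(fintype.subsetP T3W) uW; rewrite !inE uW orbT.
  under eq_finset do rewrite {1}eT3.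
  rewrite /G mulrAC ler_pdivlMr // mulrC -!natrM ler_nat -cT3.
  apply: card_essential.
    rewrite finset.disjoints_subset; apply/fintype.subsetP => u uT.
    have uW := fintype.subsetP T3W u uT.
    by rewrite finset.in_setC finset.in_setU (disjointFr dWP uW) finset.in_setD uT.
  rewrite -eT3 (leq_trans cPW) // subset_leq_card // finset.setU0 finset.setCS.
  apply/fintype.subsetP => u; rewrite !inE => /orP[->//|/orP[/eqP ->|->]];
    rewrite ?pP ?orbT //.
have cover : [set Z : graph n | (dens Z P K j finset.set0 < dens Z P K j.+1 finset.set0
  + t)%N]
    \subset B0 :|: B1 :|: \bigcup_(p in P) (near_record (fam P k j (p |: W)) W D t p
      :|: unsteady P W k j L p).
  apply/fintype.subsetP => Z; rewrite inE; apply: contraLR.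
  rewrite !finset.in_setU !negb_or => /andP[/andP[h0 h1] /bigcupP h2].
  rewrite -leqNgt; apply: (@dens_step n K L k j t P W Z eK cP dWP jK Kn).
  - by move: h0; rewrite /B0 finset.in_set negbK.
  - by move: h1; rewrite /B1 finset.in_set -leqNgt finset.setU0.
  - move=> p pP; apply/negP => hp; apply: h2; exists p => //.
    by apply/finset.setUP; left.
  - move=> p pP; apply/negP => hp; apply: h2; exists p => //.
    by apply/finset.setUP; right.
have h1 : (#|[set Z : graph n | (dens Z P K j finset.set0 < dens Z P K j.+1 finset.set0
  + t)%N]| <=
    #|B0| + #|B1| + \sum_(p in P) (#|near_record (fam P k j (p |: W)) W D t p| +
      #|unsteady P W k j L p|))%N.
  apply: leq_trans (subset_leq_card cover) _.
  apply: leq_trans (leq_card_setU _ _) _; apply: leq_add; first exact: leq_card_setU.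
  apply: leq_trans (card_bigcup_le _ _) _; apply: leq_sum => p _; exact: leq_card_setU.
move: h1; rewrite -(ler_nat R) => h1; apply: le_trans h1 _.
rewrite [leLHS]natrD [X in X + _ <= _]natrD natr_sum [leRHS]mulrDl.
apply: lerD; first by rewrite mulrDl lerD.
set y := x / _ + _.
have -> : K%:R * y * G = \sum_(p in P) (y * G) by rewrite sumr_const cP -mulrA mulr_natl.
apply: ler_sum => p pP; rewrite natrD /y mulrDl.
by apply: lerD; [apply: near | apply: steady].
Qed.

(** * From single trades to the overlap gap *)

Local Open Scope nat_scope.

Lemma Psi_attained n K (Z : graph n) (j : nat) : j <= K -> 2 * K <= n ->
  exists A : {set 'I_n}, [/\ #|A| = K, #|A :&: PC n K| = j & Psi K Z j = edges Z A].
Proof.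
move=> jK Kn; have cPC : #|PC n K| = K by apply: card_PC; lia.
have [A AP cA] : exists2 A : {set 'I_n}, A \subset PC n K & #|A| = j.
  by apply: exists_subset_card; rewrite cPC.
have [B BP cB] : exists2 B : {set 'I_n}, B \subset ~: PC n K & #|B| = K - j.
  apply: exists_subset_card; have := cardsC (PC n K); rewrite cPC card_ord => h.
  by clear -h Kn; lia.
have cS : #|A :|: B| = K.
  have dAB : [disjoint A & B].
    by rewrite finset.disjoints_subset (fintype.subset_trans AP) // -finset.setCS
      finset.setCK.
  have -> : #|A :|: B| = #|A| + #|B| by apply/eqP; rewrite (leq_card_setU A B).
  by rewrite cA cB subnKC.
have SP : (A :|: B) :&: PC n K = A.
  rewrite finset.setIUl (finset.setIidPl AP); apply/finset.setUidPl.
  have -> : B :&: PC n K = finset.set0; last exact: finset.sub0set.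
  by apply/eqP; rewrite setI_eq0 finset.disjoints_subset.
have c0 : 0 < #|[pred S : {set 'I_n} | (#|S| == K) && (#|S :&: PC n K| == j)]|.
  by apply/card_gt0P; exists (A :|: B); rewrite inE cS SP cA !eqxx.
have [S] := eq_bigmax_cond (edges Z) c0.
by rewrite inE => /andP[/eqP c1 /eqP c2] e; exists S.
Qed.

Lemma sum_gain (Y : nat -> nat) t z : (forall j, Y j.+1 <= Y j) ->
  Y z + t * z <= Y 0 + t * \sum_(j < z) (Y j < Y j.+1 + t).
Proof.
move=> Ym; elim: z => [|z IH]; first by rewrite big_ord0.
rewrite big_ord_recr /= mulnDr mulnS; have := Ym z; move: IH.
by case: ltnP; rewrite ?muln0 ?muln1; move: (t * z) (t * \sum_(j < z) _); lia.
Qed.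

(** Markov's inequality for the number of failing steps: [Y] never increases, so
    it suffices that at least half of the [z] steps gain [t]. *)
Lemma card_small_gain (R : realType) n (P : {set 'I_n}) (K t z : nat) (eta : R) :
  0 < z ->
  (forall j, j < z ->
    (#|[set Z : graph n | (dens Z P K j finset.set0 < dens Z P K j.+1 finset.set0 +
      t)%N]|%:R
      <= eta * #|{: graph n}|%:R :> R)%R) ->
  (#|[set Z : graph n | ((dens Z P K 0 finset.set0).*2 < (dens Z P K z finset.set0).*2
    + t * z)%N]|%:R
     <= 2 * eta * #|{: graph n}|%:R :> R)%R.
Proof.
move=> z0 h.
pose f (Z : graph n) := \sum_(j < z) (dens Z P K j finset.set0 < dens Z P K j.+1
  finset.set0 + t).
have sub : [set Z : graph n | (dens Z P K 0 finset.set0).*2 < (dens Z P K z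
  finset.set0).*2 + t * z]
    \subset [set Z | z < 2 * f Z].
  apply/fintype.subsetP => Z; rewrite !inE; apply: contraLR; rewrite -!leqNgt => hf.
  have := @sum_gain (fun j => dens Z P K j finset.set0) t z (fun j => dens_mono Z P K
    (leqnSn j) (finset.sub0set _)).
  have := leq_mul (leqnn t) hf.
  rewrite mulnCA -/(f Z) /=; move: (t * f Z) (t * z) (dens Z P K 0 _) (dens Z P K z _);
    clear.
  by move=> *; lia.
have m1 : z * #|[set Z | z < 2 * f Z]| <= 2 * \sum_(Z : graph n) f Z.
  rewrite card_eq_sum !big_distrr /=; apply: leq_sum => Z _.
  by case: ltnP => hz; rewrite ?muln0 // muln1 ltnW.
have z0' : (0 < z%:R :> R)%R by rewrite ltr0n.
have := leq_trans (leq_mul (leqnn z) (subset_leq_card sub)) m1.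
rewrite exchange_big /=; under eq_bigr do rewrite -card_eq_sum.
rewrite -(ler_nat R) !natrM natr_sum => h1.
rewrite -(ler_pM2l z0'); apply: le_trans h1 _.
rewrite [leRHS](_ : _ = 2%:R * \sum_(j < z) (eta * #|{: graph n}|%:R))%R; last first.
  by rewrite sumr_const card_ord -[in RHS]mulr_natl; ring.
by rewrite ler_wpM2l ?ler0n //; apply: ler_sum => j _; apply: h.
Qed.

Lemma dens_overlap0 n (Z : graph n) (P P' : {set 'I_n}) k X :
  dens Z P k 0 X = dens Z P' k 0 X.
Proof. by apply: eq_bigl => S; rewrite !inE. Qed.

Lemma Psi_plant0 n K (Z : graph n) :
  Psi K (plant K Z) 0 = dens Z (PC n K) K 0 (PC n K).
Proof.
apply: eq_big => S; first by rewrite inE /= cards_eq0 setI_eq0.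
rewrite cards_eq0 => /andP[_ /eqP S0].
have := edges_plant K Z S; rewrite S0 big_pred0; last first.
  by move=> p; rewrite /inside !inE.
by rewrite addn0 /edges [X in _ + X]big_pred0 ?addn0 // => p; rewrite /inside !inE.
Qed.

Lemma Psi_plant_le n K (Z : graph n) j z : z <= j ->
  (Psi K (plant K Z) j).*2 <= (dens Z (PC n K) K z finset.set0).*2 + j * j.
Proof.
move=> zj.
rewrite /Psi; elim/big_ind: _ => [|a b ha hb|S]; first exact: leq0n.
  by rewrite /maxn; case: ifP.
move=> /andP[/eqP cS /eqP jS].
have := edges_plant K Z S; have := card_inside (S :&: PC n K).
rewrite jS; set N := \sum_(p | _) 1 => eN e.
have h : edges Z S <= dens Z (PC n K) K z finset.set0.
  by apply: dens_ge; rewrite inE cS eqxx jS zj -setI_eq0 finset.setI0 eqxx.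
have hj : j * j.-1 <= j * j by rewrite leq_mul2l leq_pred orbT.
by move: eN e h hj; clear; lia.
Qed.

(** Half of the clique brings about [K ^ 2 / 16] edges above the mean, which
    dominates all fluctuations, of order [K * L]. *)
Lemma Psi_plant_half n (K L : nat) (Z : graph n) :
  balanced K L Z -> 0 < L -> 1152 * L <= K -> 2 * K <= n ->
  Psi K (plant K Z) 0 <= Psi K (plant K Z) K./2.
Proof.
move=> bal L0 LK Kn.
have h1 : 4 * Psi K (plant K Z) 0 <= K * K.-1 + 24 * K * L.
  rewrite Psi_plant0 /dens.
  elim/big_ind: _ => [|a b ha hb|S]; first by rewrite muln0.
    by rewrite /maxn; case: ifP.
  rewrite inE => /and3P[/eqP cS _ _].
  have cS3 : #|S| <= 3 * K by rewrite cS leq_pmull.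
  by have [_] := balancedP bal cS3; rewrite cS.
have hK : K./2 <= K by clear; lia.
have [S [cS cA ->]] := Psi_attained (plant K Z) hK Kn.
rewrite -(leq_pmul2l (isT : 0 < 4)).
have e := edges_plant K Z S.
have := card_inside (S :&: PC n K); rewrite cA.
have cS3 : #|S| <= 3 * K by rewrite cS leq_pmull.
have cA3 : #|S :&: PC n K| <= 3 * K by rewrite cA (leq_trans hK) // leq_pmull.
have [b1 _] := balancedP bal cS3; have [_ b2] := balancedP bal cA3.
rewrite cS in b1; rewrite cA in b2.
set N := \sum_(p | _) 1 in e *.
have hh : 72 * K * L <= K./2 * (K./2).-1.
  have : 3 * (72 * L) <= (K./2).-1 by lia.
  have : K <= 3 * K./2 by lia.
  move=> hK3 hL; apply: leq_trans (_ : K./2 * (3 * (72 * L)) <= _);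
    last by rewrite leq_mul2l hL orbT.
  have := leq_mul hK3 (leqnn (72 * L)); move: (K./2) => h; clear; lia.
by move: b1 b2 hh h1 e; clear; lia.
Qed.

(** * Quantitative bounds for a given number of vertices *)

Local Open Scope ring_scope.

Lemma unbalanced_small (R : realType) n (K L : nat) :
  (0 < K)%N -> (2 * L <= K)%N -> ((3 * K).+1 <= n)%N ->
  K%:R * ln (n%:R : R) <= L%:R ^+ 2 ->
  #|[set Z : graph n | ~~ balanced K L Z]|%:R <= 2 / n%:R * #|{: graph n}|%:R :> R.
Proof.
move=> K0 LK Kn hL.
have n0 : 0 < n%:R :> R by rewrite ltr0n (leq_trans _ Kn).
have n1 : 1 <= n%:R :> R by rewrite ler1n (leq_trans _ Kn).
apply: le_trans (card_unbalanced R K0 LK Kn) _.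
rewrite mulrA ler_wpM2r // mulrCA ler_wpM2l //.
have : expR (- (5 * L%:R ^+ 2)) <= (n%:R ^+ (5 * K))^-1 :> R.
  rewrite expRN lef_pV2 ?posrE ?expR_gt0 ?exprn_gt0 //.
  rewrite -[n%:R in leLHS]lnK ?posrE // -expRM_natl ler_expR natrM -mulrA.
  by rewrite ler_wpM2l.
move=> h; have p0 : 0 <= n%:R ^+ (3 * K).+1 :> R by rewrite exprn_ge0 // ltW.
apply: le_trans (ler_wpM2l p0 h) _.
have -> : (5 * K)%N = ((3 * K).+1 + (2 * K).-1)%N by lia.
rewrite exprD invfM mulrA mulfV ?mul1r ?expf_neq0 ?gt_eqF //.
rewrite lef_pV2 ?posrE ?exprn_gt0 // -[leLHS]expr1.
by rewrite ler_weXn2l //; lia.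
Qed.

(** With [D] and [k - D] both equal to [K / 2] up to [O(L)], the ratio is at most
    [(1 + O(L / K)) ^ t <= expR (O(L ^ 2 / (b * K)))], and [L ^ 2] is of order
    [K * l]: a small power of [n] if [b] is large. *)
Lemma bin_ratio_le (R : realType) (K k L b t : nat) (gamma l : R) :
  K = k.+1 -> (50 * (100 * L) <= K)%N -> (0 < L)%N -> (0 < b)%N -> (t * b <= L)%N ->
  200 * 200 <= b%:R * gamma -> 0 <= l ->
  L%:R ^+ 2 <= 4 * (K%:R * l) ->
  0 < ('C(k - (k + 600 * L)./2, t)%:R : R) /\
  'C((k + 600 * L)./2 + t, t)%:R
    <= expR (gamma / 2 * l) * 'C(k - (k + 600 * L)./2, t)%:R.
Proof.
move=> eK LK L0 b0 tb hb l0 hL; set D := ((k + 600 * L)./2)%N.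
have tL : (t <= L)%N by apply: leq_trans tb; rewrite leq_pmulr.
have hk : (K <= 8 * (k - D - t))%N by rewrite /D; clear -eK LK tL L0; lia.
have hd : (D + t <= (k - D - t) + 603 * L)%N by rewrite /D; clear -eK LK tL L0; lia.
have tk : (t <= k - D)%N by move: hk; clear -eK; lia.
have C0 : 0 < ('C(k - D, t)%:R : R) by rewrite ltr0n bin_gt0.
split=> //.
have := bin_ratio (D + t) (k - D) t.
set be := (k - D - t)%N in hk hd *; set a := (D + t)%N in hd *.
have K0 : 0 < K%:R :> R by rewrite eK ltr0n.
have be0 : 0 < be%:R :> R by rewrite ltr0n; move: hk; rewrite eK; clear; lia.
rewrite -(ler_nat R) !natrM !natrX => h.
have bt0 : 0 < be%:R ^+ t :> R by rewrite exprn_gt0.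
rewrite -(ler_pM2r bt0); apply: le_trans h _.
rewrite [leRHS]mulrAC [leRHS]mulrC ler_wpM2l //.
rewrite -ler_pdivrMr // -expr_div_n.
have ab0 : 0 <= a%:R / be%:R :> R by rewrite divr_ge0.
pose c : R := (603 * L)%:R; have c0 : 0 <= c := ler0n R _.
have ec : c = 603 * L%:R := natrM _ _ _.
clearbody c.
have e1 : a%:R / be%:R <= expR (c * 8 / K%:R) :> R.
  apply: le_trans (expR_ge1Dx _).
  rewrite ler_pdivrMr //.
  have h1 : a%:R <= be%:R + c :> R by rewrite ec -natrM -natrD ler_nat.
  have h2 : K%:R <= 8 * be%:R :> R by rewrite -natrM ler_nat.
  apply: le_trans h1 _; rewrite [leRHS]mulrDl mul1r lerD2l mulrAC ler_pdivlMr //.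
  by rewrite -mulrA ler_wpM2l.
apply: le_trans (lerXn2r t _ _ e1) _; rewrite ?nnegrE ?expR_ge0 //.
rewrite -expRM_natl ler_expR.
have b0' : 0 < b%:R :> R by rewrite ltr0n.
have htb : t%:R * b%:R <= L%:R :> R by rewrite -natrM ler_nat.
rewrite mulrA ler_pdivrMr // -(ler_pM2r b0').
have L0' : 0 <= L%:R :> R by [].
have s1 : t%:R * (c * 8) * b%:R <= 603 * 8 * L%:R ^+ 2 :> R.
  have := ler_wpM2l (mulr_ge0 c0 (ler0n R 8)) htb; rewrite ec; lra.
apply: le_trans s1 _.
have s2 : 603 * 8 * L%:R ^+ 2 <= 603 * 8 * (4 * (K%:R * l)) by lra.
apply: le_trans s2 _.
have Kl0 : 0 <= K%:R * l by rewrite mulr_ge0 // ltW.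
have := ler_wpM2r Kl0 hb.
rewrite (_ : gamma / 2 * l * K%:R * b%:R = (b%:R * gamma * (K%:R * l)) / 2);
  last by field.
by move=> h3; rewrite ler_pdivlMr //; lra.
Qed.

(** Here [s] is [sqrt n] and [q] is [n ^ (gamma / 2)] for
    [gamma = 1 / 2 - alpha], so [K * q ^ 2 <= s] says that [K <= n ^ alpha].
    The five error terms of [card_step_failure] are then all [O(1 / q)]; the
    decisive one is the number [K] of candidates in the clique times the
    probability [q / #|W|] of a near record. *)
Lemma card_no_gain (R : realType) n (K L b t w z : nat) (P : {set 'I_n}) (gamma q s : R) :
  (2 <= K)%N -> (50 * (100 * L) <= K)%N -> (0 < L)%N -> (0 < b)%N -> (t * b <= L)%N ->
  200 * 200 <= b%:R * gamma ->
  K%:R * ln (n%:R : R) <= L%:R ^+ 2 <= 4 * (K%:R * ln (n%:R : R)) ->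
  (3 <= w)%N -> (4 * (K + w) <= n)%N -> (0 < z)%N -> (2 * z <= K)%N ->
  #|P| = K ->
  q = expR (gamma / 2 * ln (n%:R : R)) -> 1 <= q -> 0 < s -> s ^+ 2 = n%:R ->
  K%:R * q ^+ 2 <= s -> w%:R <= s <= w.+1%:R ->
  #|[set Z : graph n | ((dens Z P K 0 finset.set0).*2 < (dens Z P K z finset.set0).*2 +
    t * z)%N]|%:R
     <= 74 / q * #|{: graph n}|%:R :> R.
Proof.
move=> K2 LK L0 b0 tb hb /andP[hL1 hL2] w3 hn z0 zK cP eq q1 s0 es hK /andP[ws sw].
have [k eK] : exists k, K = k.+1 by exists K.-1; rewrite prednK // (leq_trans _ K2).
have n1 : (0 < n)%N by apply: leq_trans hn; rewrite muln_gt0 /= addn_gt0 (leq_trans _ K2).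
have l0 : 0 <= ln (n%:R : R) by rewrite ln_ge0 // ler1n.
have [C0 hC] := bin_ratio_le eK LK L0 b0 tb hb l0 hL2.
have LK2 : (2 * L <= K)%N by clear - LK; lia.
have K0n : (0 < K)%N by clear - K2; lia.
have Kn3 : ((3 * K).+1 <= n)%N by clear - hn w3; lia.
clear LK hb tb.
rewrite -eq in hC.
have n0 : 0 < n%:R :> R by rewrite ltr0n.
have K0 : 0 < K%:R :> R by rewrite ltr0n (leq_trans _ K2).
have K1 : 1 <= K%:R :> R by rewrite ler1n (leq_trans _ K2).
have q0 : 0 < q by apply: lt_le_trans q1.
have hU : #|[set Z : graph n | ~~ balanced K L Z]|%:R
  <= 2 / n%:R * #|{: graph n}|%:R :> R.
  by apply: unbalanced_small hL1.
have [W WP cW] : exists2 W : {set 'I_n}, W \subset ~: P & #|W| = w.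
  by apply: exists_subset_card; have := cardsC P; rewrite cP card_ord; clear - hn; lia.
have dW : [disjoint W & P] by rewrite finset.disjoints_subset.
set eta : R := 37 / q.
have -> : 74 / q = 2 * eta by rewrite /eta; field; rewrite gt_eqF.
apply: card_small_gain => // j jz.
have jK : (2 * j.+1 <= K)%N by clear - jz zK; lia.
have := @card_step_failure R n K L k j t (n - K - w) P W (2 / n%:R) q eK cP dW jK K2 L0.
rewrite cW => /(_ _ w3 _ _ hU C0 hC) h.
apply: le_trans (h _ _ _) _; [by clear -hn; lia | by clear -hn w3; lia | by clear -hn;
  lia |].
rewrite ler_wpM2r //.
set N := (n - K - w)%N.
have hN : n%:R <= 2 * N%:R :> R by rewrite -natrM ler_nat /N; clear - hn; lia.
have N0 : 0 < N%:R :> R by lra.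
have w0 : 0 < w.+1%:R :> R by rewrite ltr0n.
have q2 : q <= q ^+ 2 by rewrite expr2 ler_peMl // ltW.
have sq : q <= s.
  by apply: (le_trans q2); apply: le_trans hK; rewrite ler_peMl // ltW // exprn_gt0.
pose r := q^-1; pose u := s^-1; pose v := K%:R * u.
have r0 : 0 < r by rewrite invr_gt0.
have r1 : r <= 1 by rewrite invf_le1.
have u0 : 0 < u by rewrite invr_gt0.
have ur : u <= r by rewrite /u /r lef_pV2 ?posrE.
have v0 : 0 <= v by rewrite mulr_ge0 // ltW.
have us : u * s = 1 by rewrite mulVf ?gt_eqF.
have rq : r * q = 1 by rewrite mulVf ?gt_eqF.
have vq2 : v * q ^+ 2 <= 1.
  by rewrite /v mulrAC -[leRHS]us [leRHS]mulrC ler_wpM2r // ltW.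
have vq : v * q <= r.
  by rewrite /r -[leRHS]mul1r ler_pdivlMr // -mulrA -expr2.
have vr : v <= r by apply: le_trans vq; rewrite ler_peMr.
have nu : n%:R^-1 = u ^+ 2 by rewrite /u -es exprVn.
have Nu : N%:R^-1 <= 2 * u ^+ 2.
  by rewrite -nu -[leLHS]mul1r ler_pdivrMr // mulrC mulrA ler_pdivlMr // mul1r mulrC.
have wu : w.+1%:R^-1 <= u by rewrite /u lef_pV2 ?posrE.
have kK : k%:R <= K%:R :> R by rewrite eK ler_nat.
have Ks : K%:R = v * s by rewrite /v -mulrA us mulr1.
have f1 : 2 / n%:R <= 2 * r.
  by rewrite ler_pM2l // nu expr2; have :=
    ler_pM (ltW u0) (ltW u0) ur (le_trans ur r1); lra.
have f2 : w%:R * K%:R / N%:R <= 2 * r.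
  have iN0 : 0 <= N%:R^-1 :> R by rewrite invr_ge0 ltW.
  have wK0 : 0 <= w%:R * K%:R :> R by rewrite mulr_ge0.
  apply: (le_trans (ler_pM wK0 iN0 (ler_wpM2r (ltW K0) ws) Nu)).
  rewrite Ks (_ : _ * _ * _ = 2 * v * (u * s) ^+ 2); last by ring.
  by rewrite us expr1n mulr1 ler_pM2l.
have f3 : K%:R * (q / w.+1%:R) <= r.
  apply: le_trans vq; rewrite /v -mulrA ler_wpM2l // mulrC.
  by rewrite ler_wpM2r // ltW.
have f4 : K%:R * (2 / n%:R) <= 2 * r.
  rewrite nu mulrCA ler_pM2l // expr2 mulrA -/v.
  by have := ler_pM v0 (ltW u0) vr (le_trans ur r1); lra.
have f5 : K%:R * (3 * k%:R / N%:R) <= 6 * r.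
  have h1 : k%:R / N%:R <= K%:R * (2 * u ^+ 2).
    by apply: ler_pM; rewrite ?invr_ge0 // ltW.
  apply: le_trans (_ : _ <= K%:R * (3 * (K%:R * (2 * u ^+ 2)))) _.
    by rewrite ler_pM2l // -mulrA ler_pM2l.
  rewrite (_ : _ * _ = 6 * (v * v)); last by rewrite /v; ring.
  by rewrite ler_pM2l //; have := ler_pM v0 v0 vr (le_trans vr r1); lra.
have -> : eta = 37 * r by [].
rewrite [K%:R * (_ + _)]mulrDr [K%:R * (4 * _)]mulrCA [K%:R * (_ + _)]mulrDr.
move: f1 f2 f3 f4 f5.
move: (_ / N%:R) (2 / n%:R) (K%:R * (3 * _ / _)) (K%:R * (2 / n%:R)) (K%:R * (q / _)).
by move: (r); clear => r *; lra.
Qed.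

(** The densest set meets a given set of [K] vertices with probability at most
    of order [K ^ 2 / n]. *)
Lemma card_clique_hit (R : realType) n (K w : nat) (q s : R) :
  (0 < K)%N -> (4 * (K + w) <= n)%N ->
  1 <= q -> 0 < s -> s ^+ 2 = n%:R -> K%:R * q ^+ 2 <= s ->
  #|[set Z : graph n | (dens Z finset.set0 K 0 (PC n K) < dens Z finset.set0 K 0
    finset.set0)%N]|%:R
    <= 2 / q * #|{: graph n}|%:R :> R.
Proof.
move=> K0 hn q1 s0 es hK.
have cPC : #|PC n K| = K by apply: card_PC; lia.
have := @card_essential n finset.set0 K 0 finset.set0 (PC n K) (n - K).
rewrite !finset.setU0 finset.set0U -setI_eq0 finset.setI0 eqxx cPC => /(_ isT).
have -> : (n - K <= #|~: PC n K|)%N.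
  by have := cardsC (PC n K); rewrite card_ord cPC; lia.
move=> /(_ isT); rewrite -(ler_nat R) !natrM => h.
have q0 : 0 < q by apply: lt_le_trans q1.
have hN : n%:R <= 2 * (n - K)%:R :> R by rewrite -natrM ler_nat; lia.
have n0 : 0 < n%:R :> R by rewrite -es exprn_gt0.
have N0 : 0 < (n - K)%:R :> R by lra.
rewrite -(ler_pM2l N0); apply: le_trans h _.
rewrite mulrA ler_wpM2r // mulrA ler_pdivlMr //.
have K1 : 0 < K%:R :> R by rewrite ltr0n.
have q2 : q <= q ^+ 2 by rewrite expr2 ler_peMl // ltW.
have Kq : K%:R * q <= s by apply: le_trans hK; rewrite ler_pM2l.
have Ks : K%:R <= s by apply: le_trans Kq; rewrite ler_peMr // ltW.
have := ler_pM (ltW K1) (ltW (mulr_gt0 K1 q0)) Ks Kq.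
rewrite -expr2 es; lra.
Qed.

(** * Sizes of the parameters *)

Lemma powR_nat_expR (R : realType) (n : nat) (a : R) : (0 < n)%N ->
  n%:R `^ a = expR (a * ln n%:R).
Proof. by move=> n0; rewrite mulrC expRM lnK // posrE ltr0n. Qed.

Lemma truncn_bounds (R : realType) (x : R) : 0 <= x ->
  (Num.truncn x)%:R <= x /\ x < (Num.truncn x)%:R + 1.
Proof. by move=> x0; have /andP[] := truncn_itv x0; rewrite -natr1. Qed.

(** The reservoir has [w = floor (sqrt n)] vertices and [L] is
    [sqrt (K log n)] rounded up. All requirements hold as soon as [ln n] is
    large, since [n ^ (alpha / 2) >= alpha / 2 * ln n] while [K] is about the
    square of the left-hand side. *)
Lemma parameter_sizes (R : realType) (alpha D : R) (b n : nat) :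
  let K := Ksize alpha n in let l := ln (n%:R : R) in
  let gamma := 1 / 2 - alpha in
  let s := expR (l / 2) in
  0 < alpha < 1 / 2 -> 0 < D -> (0 < b)%N -> (0 < n)%N ->
  16 <= l -> 4 * 100 ^+ 4 / alpha <= alpha * l / 2 ->
  2 * expR 1 <= alpha * l / 2 -> 2 * (4 / D ^+ 2) <= alpha * l / 2 ->
  2 * (4 * b%:R ^+ 2) <= alpha * l / 2 ->
  exists L w,
  [/\ [/\ (2 <= K)%N, (50 * (100 * L) <= K)%N, (2 * b <= L)%N, (3
    <= w)%N & (4 * (K + w) <= n)%N],
      [/\ K%:R * l <= L%:R ^+ 2 <= 4 * (K%:R * l), s ^+ 2 = n%:R,
          K%:R * expR (gamma / 2 * l) ^+ 2 <= s & w%:R <= s <= w.+1%:R],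
      1 <= ln (K%:R : R) <= l, 2 <= D * Num.sqrt (K%:R * ln K%:R) &
      Num.sqrt (K%:R * ln K%:R) <= L%:R :> R].
Proof.
move=> K l gamma s /andP[a0 a1] D0 b0 n0 l16 h1 h2 h3 h4.
have n0' : 0 < n%:R :> R by rewrite ltr0n.
have l0 : 0 < l by lra.
pose X := expR (alpha * l / 2).
have XE : 1 + alpha * l / 2 <= X by exact: expR_ge1Dx.
have al0 : 0 < alpha * l / 2 by rewrite divr_gt0 // mulr_gt0.
have X2 : X ^+ 2 = n%:R `^ alpha by rewrite powR_nat_expR // -expRM_natl -/l;
  congr expR; field.
have [Kle Kgt] : K%:R <= X ^+ 2 /\ X ^+ 2 < K%:R + 1.
  by rewrite X2 /K /Ksize; apply: truncn_bounds; apply: powR_ge0.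
have e1 : 1 + 1 <= expR 1 :> R by exact: expR_ge1Dx.
have X4 : 4 <= X by lra.
have XX : 4 * X <= X ^+ 2 by rewrite expr2 ler_pM2r //; lra.
have KX : X ^+ 2 <= 2 * K%:R by lra.
have Kbig c : 2 * c <= alpha * l / 2 -> c <= K%:R by move=> hc; lra.
have K1 : expR 1 <= K%:R :> R by exact: Kbig.
have K0 : 0 < K%:R :> R by lra.
have lnK1 : 1 <= ln (K%:R : R).
  by rewrite -[leLHS]expRK ler_ln // posrE // expR_gt0.
have Kn : K%:R <= n%:R :> R.
  apply: le_trans Kle _; rewrite X2 powR_nat_expR //.
  rewrite -[leRHS]lnK ?posrE // ler_expR -/l ler_piMl //; lra.
have lnKl : ln (K%:R : R) <= l by rewrite /l ler_ln ?posrE.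
pose S := Num.sqrt (K%:R * l).
have Kl0 : 0 <= K%:R * l by rewrite mulr_ge0 // ltW.
have S2 : S ^+ 2 = K%:R * l by rewrite sqr_sqrtr.
have S0 : 0 <= S by exact: sqrtr_ge0.
have [Lle Lgt] := truncn_bounds S0.
pose L := (Num.truncn S).+1.
have LE : L%:R = (Num.truncn S)%:R + 1 :> R by rewrite /L -natr1.
clearbody L.
have S_ge c : 0 <= c -> c ^+ 2 <= K%:R -> c <= S.
  move=> c0 cK; rewrite -(ler_sqr _ _) ?nnegrE // S2; apply: le_trans cK _.
  by rewrite ler_peMr //; lra.
have S1 : 1 <= S by apply: S_ge; rewrite ?expr1n //; lra.
(* This is [50 * 200 * S <= K] squared and divided by [K]. *)
have hl : 100 ^+ 4 * l <= K%:R.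
  have : l <= 2 / alpha * X.
    rewrite mulrAC ler_pdivlMr //; lra.
  have hX : 4 * 100 ^+ 4 / alpha <= X by lra.
  have : 4 * 100 ^+ 4 / alpha * X <= X ^+ 2 by rewrite expr2 ler_pM2r //; lra.
  have -> : 4 * 100 ^+ 4 / alpha * X = 2 * 100 ^+ 4 * (2 / alpha * X) by field;
    rewrite gt_eqF.
  move: (2 / alpha * X) => Y hY1 hY2; move: KX hY1 hY2; clear; move: (X ^+ 2) => X2; lra.
have hS : 50 * 200 * S <= K%:R.
  rewrite -(ler_sqr _ _) ?nnegrE ?mulr_ge0 // ?(ltW K0) //.
  rewrite exprMn S2.
  have -> : (50 * 200) ^+ 2 * (K%:R * l) = K%:R * (100 ^+ 4 * l) :> R by ring.
  by rewrite expr2 ler_pM2l.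
have s0 : 0 < s by exact: expR_gt0.
have s8 : 8 <= s by have : 1 + l / 2 <= s := expR_ge1Dx _; lra.
have es : s ^+ 2 = n%:R.
  by rewrite /s -expRM_natl (_ : 2%:R * (l / 2) = l) ?lnK ?posrE //; field.
have [wle wgt] := truncn_bounds (ltW s0).
pose w := Num.truncn s.
exists L, w.
have g0 : 0 < gamma by rewrite /gamma; lra.
have Kq : K%:R * expR (gamma / 2 * l) ^+ 2 <= s.
  rewrite -expRM_natl; apply: le_trans (ler_wpM2r (expR_ge0 _) Kle) _.
  rewrite X2 powR_nat_expR // -expRD ler_expR -/l /gamma.
  by rewrite le_eqVlt; apply/orP; left; apply/eqP; field.
have q1 : 1 <= expR (gamma / 2 * l) ^+ 2.
  rewrite -expRM_natl -expR0 ler_expR mulr_ge0 // mulr_ge0 // ?(ltW l0) //.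
  by rewrite divr_ge0 // ltW.
have Ks : K%:R <= s by apply: le_trans Kq; rewrite ler_peMr // ltW.
have SK : Num.sqrt (K%:R * ln K%:R) <= S.
  by rewrite ler_sqrt // ler_pM2l.
split.
- split.
  + by rewrite -(ler_nat R); lra.
  + rewrite -(ler_nat R) !natrM; move: LE Lle hS S1; clear; move=> *; lra.
  + rewrite -(ler_nat R) natrM LE; apply: le_trans (_ : _ <= S) _; last exact: ltW.
    apply: S_ge; first by rewrite mulr_ge0.
    by rewrite exprMn -natrX; apply: le_trans (Kbig _ h4); rewrite -natrX.
  + by rewrite -(ler_nat R) /w; lra.
  + rewrite -(ler_nat R) natrM natrD -es.
    have : 8 * s <= s ^+ 2 by rewrite expr2 ler_pM2r.
    by rewrite -/w in wle; lra.
- split=> //.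
  + rewrite -S2 LE; apply/andP; split.
      by rewrite ler_sqr ?nnegrE ?addr_ge0 // ltW.
    have -> : 4 * S ^+ 2 = (2 * S) ^+ 2 by ring.
    by rewrite ler_sqr ?nnegrE ?addr_ge0 ?mulr_ge0 //; lra.
  + by rewrite -natr1 wle /= ltW.
- by rewrite lnK1.
- have D2 : 0 < D ^+ 2 by rewrite exprn_gt0.
  have hD := Kbig _ h3.
  rewrite -(ler_sqr _ _) ?nnegrE ?mulr_ge0 ?sqrtr_ge0 // ?(ltW D0) //.
  rewrite exprMn sqr_sqrtr; last by rewrite mulr_ge0 // ?(ltW K0) //; lra.
  rewrite ler_pdivrMr // in hD; rewrite mulrA.
  have : K%:R * D ^+ 2 <= D ^+ 2 * K%:R * ln K%:R by rewrite [K%:R * _]mulrC ler_peMr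
    // mulr_ge0 // ltW.
  by move: hD; lra.
- by apply: le_trans SK _; rewrite LE ltW.
Qed.

(** * Overlap gap with high probability *)

Lemma whp_of_card (R : realType) (K : nat -> nat) (E : forall n, graph n -> Prop) :
  (forall e : R, 0 < e -> exists M : R, forall n, M <= n%:R ->
     exists2 B : {set graph n}, #|B|%:R <= e * #|{: graph n}|%:R :> R &
       forall Z, Z \notin B -> E n (plant (K n) Z)) ->
  whp R K E.
Proof.
move=> h; apply/cvgrPdist_le => e e0.
have [M hM] := h e e0.
have := nbhs_infty_ger M; apply: filterS => n /hM[B cB hB].
rewrite planted_probE; set A := [set Z | _].
have G0 : 0 < #|{: graph n}|%:R :> R.
  by rewrite card_ffun card_bool natrX exprn_gt0.
have AB : (#|{: graph n}| <= #|A| + #|B|)%N.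
  rewrite -(cardsC B) addnC leq_add2r subset_leq_card //.
  by apply/fintype.subsetP => Z; rewrite finset.in_setC => /hB hZ;
    rewrite /A finset.in_set; apply/asboolP.
have AG : #|A|%:R <= #|{: graph n}|%:R :> R by rewrite ler_nat max_card.
rewrite -(ler_nat R) natrD in AB.
rewrite ger0_norm; last by rewrite subr_ge0 ler_pdivrMr // mul1r.
rewrite lerBlDr -lerBlDl ler_pdivlMr // mulrBl mul1r; lra.
Qed.

(** The linear loss beats the quadratic gain. Put [x = D * zt], the lower end of
    the forbidden overlaps. Doubled, the loss is [(L %/ b) * z], at least
    [L / (2 * b) * (x / 2) >= x ^ 2 / (4 * b * D) = 8 * x ^ 2], whereas planting
    adds at most [(2 * x) ^ 2] to twice the edge count. *)
Lemma max_Psi_gap (R : realType) n (K L b z : nat) (D : R) (Z : graph n) :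
  let zt := Num.sqrt (K%:R * ln (K%:R : R)) in
  (0 < b)%N -> D = 1 / (32 * b%:R) -> (2 * b <= L)%N -> zt <= L%:R -> 2 <= D * zt ->
  z = Num.truncn (D * zt) ->
  (dens Z finset.set0 K 0 finset.set0 <= dens Z finset.set0 K 0 (PC n K))%N ->
  ((dens Z (PC n K) K z finset.set0).*2 + (L %/ b) * z
    <= (dens Z (PC n K) K 0 finset.set0).*2)%N ->
  (Psi K (plant K Z) 0 <= Psi K (plant K Z) K./2)%N ->
  (max_Psi K (plant K Z) (D * zt) (2 * D * zt))%:R
    <= Num.min (Psi K (plant K Z) 0)%:R (Psi K (plant K Z) K./2)%:R - 2 * (D * zt) ^+ 2
      :> R.
Proof.
move=> zt b0 eD bL ztL D2 ez hit gain half.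
have b0' : 0 < b%:R :> R by rewrite ltr0n.
have D0 : 0 < D by rewrite eD divr_gt0 // mulr_gt0.
have zt0 : 0 <= zt by exact: sqrtr_ge0.
have -> : Num.min (Psi K (plant K Z) 0)%:R (Psi K (plant K Z) K./2)%:R = (Psi K (plant
  K Z) 0)%:R :> R.
  by apply/min_idPl; rewrite ler_nat.
have -> : Psi K (plant K Z) 0 = dens Z (PC n K) K 0 finset.set0.
  have e X : dens Z (PC n K) K 0 X = dens Z finset.set0 K 0 X by exact: dens_overlap0.
  rewrite Psi_plant0 !e; apply/eqP; rewrite eqn_leq hit andbT.
  by apply: dens_mono => //; apply: finset.sub0set.
move: gain; set Y0 := dens _ _ K 0 _; set Yz := dens _ _ K z _; move=> gain.
have Dz0 : 0 <= D * zt by rewrite mulr_ge0 // ltW.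
have [zle zgt] := truncn_bounds Dz0; rewrite -ez in zle zgt.
have maxle : 2 * (max_Psi K (plant K Z) (D * zt) (2 * D * zt))%:R
  <= 2 * Yz%:R + 4 * (D * zt) ^+ 2 :> R.
  rewrite /max_Psi; elim/big_ind: _ => [|x y hx hy|j /andP[j1 j2]].
  - by rewrite mulr0n mulr0 addr_ge0 // mulr_ge0 // sqr_ge0.
  - by rewrite /maxn; case: ifP.
  have zj : (z <= j)%N by rewrite -(ler_nat R); apply: le_trans zle j1.
  have := Psi_plant_le K Z zj; rewrite -!mul2n -(ler_nat R) natrD !natrM => h.
  apply: le_trans h _; rewrite lerD2l.
  have -> : 4 * (D * zt) ^+ 2 = (2 * D * zt) * (2 * D * zt) by ring.
  by apply: ler_pM.
have tz : 16 * (D * zt) ^+ 2 <= 2 * ((L %/ b) * z)%:R.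
  have h1 : L%:R / 2 <= (L %/ b)%:R * b%:R :> R.
    have := divn_eq L b; have := ltn_mod L b; rewrite b0 => hm hd.
    have : (L <= 2 * (L %/ b * b))%N.
      by move: hm hd bL; move: (L %/ b * b)%N (L %% b)%N; clear; lia.
    by rewrite -(ler_nat R) !natrM => h; lra.
  have h2 : D * zt / 2 <= z%:R by lra.
  have h3 : (L%:R / 2) * (D * zt / 2) <= (L %/ b)%:R * b%:R * z%:R :> R.
    by apply: ler_pM => //; rewrite divr_ge0.
  have h4 : zt * (D * zt) <= L%:R * (D * zt) by rewrite ler_wpM2r.
  have bD : b%:R * D = 1 / 32 by rewrite eD; field; rewrite gt_eqF.
  have : b%:R * (8 * (D * zt) ^+ 2) <= b%:R * ((L %/ b)%:R * z%:R) :> R.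
    rewrite (_ : b%:R * (8 * _) = (b%:R * D) * 8 * (zt * (D * zt))); last by ring.
    rewrite bD (_ : b%:R * (_ * _) = (L %/ b)%:R * b%:R * z%:R); last by ring.
    by apply: le_trans h3; lra.
  rewrite ler_pM2l // natrM; lra.
move: gain; rewrite -!mul2n -(ler_nat R) natrD !natrM in tz *; lra.
Qed.

(** The gap is stated with twice the constant needed, which leaves room for the
    strict positivity of [r1] in the overlap gap property. *)
Lemma card_no_gap (R : realType) (alpha D : R) (b : nat) :
  let K := Ksize alpha in
  0 < alpha < 1 / 2 -> (0 < b)%N -> 200 * 200 <= b%:R * (1 / 2 - alpha) ->
  D = 1 / (32 * b%:R) ->
  forall e : R, 0 < e -> exists M : R, forall n, M <= n%:R ->
    [/\ (2 * K n <= n)%N, 1 <= ln ((K n)%:R : R), 2 <= zeta K D n &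
        zeta K (2 * D) n <= ((K n)./2)%:R] /\
    exists2 B : {set graph n}, #|B|%:R <= e * #|{: graph n}|%:R :> R &
      forall Z, Z \notin B ->
        (max_Psi (K n) (plant (K n) Z) (zeta K D n) (zeta K (2 * D) n))%:R
        <= Num.min (Psi (K n) (plant (K n) Z) 0)%:R
                   (Psi (K n) (plant (K n) Z) (K n)./2)%:R
           - 2 * (D ^+ 2 * (K n)%:R * ln (K n)%:R) :> R.
Proof.
move=> K ha b0 hb eD e e0; have /andP[a0 a1] := ha.
have b0' : 0 < b%:R :> R by rewrite ltr0n.
have b1 : 1 <= b%:R :> R by rewrite ler1n.
have D0 : 0 < D by rewrite eD divr_gt0 // mulr_gt0.
have D1 : 2 * D <= 1 by rewrite eD mulrA mulr1 ler_pdivrMr; [lra | rewrite mulr_gt0].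
pose gamma := 1 / 2 - alpha; have g0 : 0 < gamma by rewrite /gamma; lra.
pose c1 : R := 4 * 100 ^+ 4 / alpha; pose c2 : R := 2 * expR 1.
pose c3 : R := 2 * (4 / D ^+ 2); pose c4 : R := 2 * (4 * b%:R ^+ 2).
pose c5 : R := 78 / e.
have c1p : 0 <= c1 by rewrite divr_ge0 ?(ltW a0) // mulr_ge0 // exprn_ge0.
have c2p : 0 <= c2 by rewrite mulr_ge0 // expR_ge0.
have c3p : 0 <= c3 by rewrite mulr_ge0 // divr_ge0 // sqr_ge0.
have c4p : 0 <= c4 by rewrite !mulr_ge0 // sqr_ge0.
have c5p : 0 <= c5 by rewrite divr_ge0 // ltW.
pose m := 16 + 2 / alpha * (c1 + c2 + c3 + c4) + 2 / gamma * c5.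
have ia : 0 < 2 / alpha by rewrite divr_gt0.
have ig : 0 < 2 / gamma by rewrite divr_gt0.
exists (expR m) => n hn.
have n0' : 0 < n%:R :> R by apply: lt_le_trans hn; exact: expR_gt0.
have n0 : (0 < n)%N by rewrite -(ltr0n R).
set l := ln (n%:R : R).
have lm : m <= l by rewrite -[m]expRK ler_ln // posrE expR_gt0.
have p1 : 0 <= 2 / alpha * (c1 + c2 + c3 + c4).
  by rewrite mulr_ge0 ?(ltW ia) // !addr_ge0.
have p2 : 0 <= 2 / gamma * c5 by rewrite mulr_ge0 ?(ltW ig).
have l16 : 16 <= l by apply: le_trans lm; rewrite /m; lra.
have hsum : c1 + c2 + c3 + c4 <= alpha * l / 2.
  have : 2 / alpha * (c1 + c2 + c3 + c4) <= l by apply: le_trans lm; rewrite /m; lra.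
  by rewrite mulrAC ler_pdivrMr //; lra.
have h5 : c5 <= gamma * l / 2.
  have : 2 / gamma * c5 <= l by apply: le_trans lm; rewrite /m; lra.
  by rewrite mulrAC ler_pdivrMr //; lra.
have H1 : c1 <= alpha * l / 2 by apply: le_trans hsum; clear - c2p c3p c4p; lra.
have H2 : c2 <= alpha * l / 2 by apply: le_trans hsum; clear - c1p c3p c4p; lra.
have H3 : c3 <= alpha * l / 2 by apply: le_trans hsum; clear - c1p c2p c4p; lra.
have H4 : c4 <= alpha * l / 2 by apply: le_trans hsum; clear - c1p c2p c3p; lra.
have [L [w [[K2 LK bL w3 hKw] [hL es hKq ws] /andP[lnK1 lnKl] hD ztL]]] :=
  parameter_sizes ha D0 b0 n0 l16 H1 H2 H3 H4.
rewrite -/(K n) -/l -/gamma in K2 LK hKw hL es hKq ws lnK1 lnKl hD ztL.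
move: es hKq ws; set s := expR (l / 2); set q := expR (gamma / 2 * l) => es hKq ws.
have s0 : 0 < s by exact: expR_gt0.
have q5 : 1 + c5 <= q.
  by have : 1 + gamma / 2 * l <= q := expR_ge1Dx _; lra.
have q1 : 1 <= q by lra.
have q0 : 0 < q by lra.
have L0 : (0 < L)%N by clear - bL b0; lia.
set kn := K n in K2 LK hKw hL hKq lnK1 lnKl hD ztL *.
have K0 : 0 < kn%:R :> R by rewrite ltr0n; clear - K2; lia.
have Kl0 : 0 <= kn%:R * ln (kn%:R : R) by rewrite mulr_ge0 ?(ltW K0) //; lra.
set zt := Num.sqrt (kn%:R * ln (kn%:R : R)) in hD ztL.
have zt0 : 0 <= zt by exact: sqrtr_ge0.
have hz2 : zeta K (2 * D) n <= (kn./2)%:R.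
  rewrite /zeta -/kn -/zt; apply: le_trans (ler_wpM2r zt0 D1) _.
  rewrite mul1r; apply: le_trans ztL _; rewrite ler_nat.
  by clear - LK; lia.
have Kn2 : (2 * kn <= n)%N by clear - hKw; lia.
split; first by [].
pose z := Num.truncn (D * zt).
have Dz0 : 0 <= D * zt by rewrite mulr_ge0 // ltW.
have [zle zgt] := truncn_bounds Dz0.
have z0 : (0 < z)%N by rewrite truncn_gt0; lra.
have zK : (2 * z <= kn)%N.
  have : (z <= L)%N.
    rewrite -(ler_nat R); apply: le_trans zle _; apply: le_trans ztL.
    by rewrite ler_piMl //; lra.
  by clear - LK; lia.
have tb : (L %/ b * b <= L)%N by exact: leq_divM.
have K0n : (0 < kn)%N by clear - K2; lia.
have cPC : #|PC n kn| = kn by apply: card_PC; clear -Kn2; lia.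
pose B1 := [set Z : graph n | ~~ balanced kn L Z].
pose B2 := [set Z : graph n | (dens Z finset.set0 kn 0 (PC n kn) < dens Z finset.set0
  kn 0 finset.set0)%N].
pose B3 := [set Z : graph n | ((dens Z (PC n kn) kn 0 finset.set0).*2 <
   (dens Z (PC n kn) kn z finset.set0).*2 + (L %/ b) * z)%N].
have cB1 : #|B1|%:R <= 2 / q * #|{: graph n}|%:R :> R.
  have LK2 : (2 * L <= kn)%N by clear - LK; lia.
  have Kn3 : ((3 * kn).+1 <= n)%N by clear - hKw w3; lia.
  have /andP[hL1 _] := hL.
  apply: le_trans (unbalanced_small K0n LK2 Kn3 hL1) _.
  rewrite ler_wpM2r // ler_pM2l // lef_pV2 ?posrE // -es.
  have q2 : q <= q ^+ 2 by rewrite expr2 ler_peMl // ltW.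
  have K1 : 1 <= kn%:R :> R by rewrite ler1n.
  have Kq : q ^+ 2 <= s by apply: le_trans hKq; rewrite ler_peMl // sqr_ge0.
  have sq : q <= s by apply: le_trans Kq.
  by apply: le_trans sq _; rewrite expr2 ler_peMl ?(ltW s0) //; lra.
have cB2 : #|B2|%:R <= 2 / q * #|{: graph n}|%:R :> R.
  exact: (card_clique_hit K0n hKw q1 s0 es hKq).
have cB3 : #|B3|%:R <= 74 / q * #|{: graph n}|%:R :> R.
  by apply: (card_no_gain K2 LK L0 b0 tb hb hL w3 hKw z0 zK cPC _ q1 s0 es hKq ws).
exists (B1 :|: B2 :|: B3).
  have h1 : (#|B1 :|: B2 :|: B3| <= #|B1| + #|B2| + #|B3|)%N.
    by apply: leq_trans (leq_card_setU _ _) _; rewrite leq_add2r; apply: leq_card_setU.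
  move: h1; rewrite -(ler_nat R) !natrD => h1; apply: le_trans h1 _.
  have G0 : 0 <= #|{: graph n}|%:R :> R by [].
  have qe : 78 / q <= e by rewrite ler_pdivrMr // mulrC -ler_pdivrMr // -/c5; lra.
  apply: le_trans (ler_wpM2r G0 qe).
  move: cB1 cB2 cB3; clear; move=> *; lra.
move=> Z; rewrite !finset.in_setU !negb_or => /andP[/andP[n1 n2] n3].
have bal : balanced kn L Z by move: n1; rewrite /B1 finset.in_set negbK.
have hit : (dens Z finset.set0 kn 0 finset.set0 <= dens Z finset.set0 kn 0 (PC n kn))%N.
  by move: n2; rewrite /B2 finset.in_set -leqNgt.
have gain : ((dens Z (PC n kn) kn z finset.set0).*2 + (L %/ b) * z
  <= (dens Z (PC n kn) kn 0 finset.set0).*2)%N.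
  by move: n3; rewrite /B3 finset.in_set -leqNgt.
have half : (Psi kn (plant kn Z) 0 <= Psi kn (plant kn Z) kn./2)%N.
  have LK' : (1152 * L <= kn)%N by clear - LK; lia.
  exact: Psi_plant_half bal L0 LK' Kn2.
have -> : D ^+ 2 * kn%:R * ln kn%:R = (D * zt) ^+ 2 by rewrite exprMn sqr_sqrtr // mulrA.
exact: max_Psi_gap b0 eD bL ztL hD (erefl z) hit gain half.
Qed.

Theorem theorem2p12 (R : realType) (alpha : R) (halpha : 0 < alpha < 1 / 2) :
  let K := Ksize alpha in
  exists C1 D1 D2 : R,
    [/\ 0 < C1, 0 < D1, D1 < D2,
        whp R K (fun n (Z : graph n) =>
          (max_Psi (K n) Z (zeta K D1 n) (zeta K D2 n))%:R
            <= Num.min (Psi (K n) Z 0)%:R (Psi (K n) Z (K n)./2)%:R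
               - C1 * (K n)%:R * ln (K n)%:R) &
        OGP K (zeta K D1) (zeta K D2) (@r1 R K C1) (@r2 R K)].
Proof.
move=> K; have /andP[a0 a1] := halpha.
pose gamma := 1 / 2 - alpha; have g0 : 0 < gamma by rewrite /gamma; lra.
(* [b] is the factor by which the gain [t] per step is smaller than [L]. *)
pose b := (Num.truncn (200 * 200 / gamma : R)).+1.
have b0 : (0 < b)%N by [].
have hb : 200 * 200 <= b%:R * (1 / 2 - alpha).
  have x0 : 0 <= 200 * 200 / gamma by rewrite divr_ge0 ?mulr_ge0 // ltW.
  have /andP[_ /ltW] := truncn_itv x0.
  by rewrite -/b ler_pdivrMr.
pose D : R := 1 / (32 * b%:R).
have D0 : 0 < D by rewrite divr_gt0 // mulr_gt0 // ltr0n.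
have D20 : 0 < D ^+ 2 by rewrite exprn_gt0.
have key := card_no_gap halpha b0 hb (erefl D); rewrite -/K in key.
have lnK_pos n : 1 <= ln ((K n)%:R : R) -> 0 < D ^+ 2 * (K n)%:R * ln (K n)%:R.
  move=> h; have K0 : (0 < K n)%N.
    by case: (posnP (K n)) h => // ->; rewrite ln0 //; lra.
  by apply: mulr_gt0; [apply: mulr_gt0; rewrite ?ltr0n | lra].
exists (D ^+ 2), D, (2 * D); split=> //.
- by lra.
- apply: whp_of_card => e e0; have [M hM] := key e e0; exists M => n /hM[[_ l1 _ _] [B cB hB]].
  exists B => // Z /hB h; apply: le_trans h _; rewrite lerD2l lerN2.
  by have := lnK_pos n l1; lra.
split.
  have [M hM] := key 1 ltr01.
  apply: filterS (nbhs_infty_ger M) => n /hM[[Kn l1 z2 zK] _].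
  have zz : zeta K (2 * D) n = 2 * zeta K D n by rewrite /zeta mulrA.
  split; [lra | lra |].
  apply: le_lt_trans zK _; rewrite ltr_nat.
  by have := lnK_pos n l1; case: (K n) => [|[|k]] //; rewrite ?mulr0 ?mul0r ?ltxx //; clear; lia.
apply: whp_of_card => e e0; have [M hM] := key e e0; exists M => n /hM[[Kn l1 z2 zK] [B cB hB]].
exists B => // Z /hB; set Z' := plant (K n) Z; rewrite -/(r2 R K Z').
have p0 := lnK_pos n l1.
rewrite /r1; set mp := max_Psi _ _ _ _; set d := D ^+ 2 * _ * _ in p0 *.
move=> h; have mp0 : 0 <= mp%:R :> R by [].
split.
- by apply/andP; split; lra.
- have [A [cA jA eA]] := Psi_attained Z' (leq0n (K n)) Kn.
  have hK : ((K n)./2 <= K n)%N by clear; lia.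
  have [A' [cA' jA' eA']] := Psi_attained Z' hK Kn.
  exists A, A'; rewrite jA jA' -eA -eA'; split=> //; first by rewrite mulr0n; lra.
  by rewrite /r2 !ge_min !lexx orbT.
- move=> A cA hz; apply: (@le_trans _ _ mp%:R); last lra.
  rewrite ler_nat; apply: (@leq_trans (Psi (K n) Z' #|A :&: PC n (K n)|)).
    by rewrite /Psi; apply: leq_bigmax_cond; rewrite cA !eqxx.
  have jK : (#|A :&: PC n (K n)| < (K n).+1)%N.
    by rewrite ltnS -{2}cA subset_leq_card // finset.subsetIl.
  exact: (@leq_bigmax_cond _ (fun z : 'I_(K n).+1 => zeta K D n <= z%:R <= zeta K (2 * D) n)
    (fun z => Psi (K n) Z' z) (Ordinal jK)).
Qed.
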